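(* Let $N\ge 1$, let $f:Z[1,N]\times\mathbb{R}\to\mathbb{R}$ be continuous in its second variable and odd in its second variable for every $k\in Z[1,N]$, and let $p:Z[1,N+2]\to\mathbb{R}$, $q:Z[1,N+1]\to\mathbb{R}$. Assume that (1) $p_{\min}\ge 0$; (2) $\min_{k\in Z[1,N]}\lim_{s\to\infty}\frac{f(k,s)}{s}>\alpha_1$; (3) $\max_{k\in Z[1,N]}\lim_{s\to0^+}\frac{f(k,s)}{s}<\alpha_2$ (all limits assumed to exist, those at $\infty$ possibly equal to $+\infty$). Then the boundary value problem $$\Delta^2\big(p(k)\Delta^2 y(k-2)\big)+\Delta\big(q(k)\Delta y(k-1)\big)+f(k,y(k))=0\ \ (k\in Z[1,N]),\qquad y(-1)=y(0)=y(N+1)=y(N+2)=0$$ has at least $2N$ distinct solutions.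
   Context: $Z[a,b]=[a,b]\cap\mathbb{Z}$; $\Delta x(k)=x(k+1)-x(k)$, $\Delta^2=\Delta\circ\Delta$; $\Delta^2(p(k)\Delta^2y(k-2))$ means $\Delta^2$ applied to $k\mapsto p(k)\Delta^2 y(k-2)$, similarly for $\Delta(q(k)\Delta y(k-1))$. A solution is a function $y:Z[-1,N+2]\to\mathbb{R}$ satisfying the equation and boundary conditions. $p_{\min},p_{\max}$ are the min and max of $p$ over $Z[1,N+2]$, $q_{\min},q_{\max}$ those of $q$ over $Z[1,N+1]$. Let $E=\{y:Z[-1,N+2]\to\mathbb{R}\mid y(-1)=y(0)=y(N+1)=y(N+2)=0\}$ and $\tilde y=(y(1),\dots,y(N))^T$; $V$ is the $(N+1)\times N$ matrix with $V\tilde y=(\Delta y(0),\dots,\Delta y(N))^T$ and $W$ the $(N+2)\times N$ matrix with $W\tilde y=(\Delta^2y(-1),\dots,\Delta^2y(N))^T$ for $y\in E$; $\lambda_1,\lambda_2$ are the smallest eigenvalues of $V^TV$, $W^TW$. $\eta'(p)=\lambda_2$ if $p_{\min}\ge0$, $16$ if $p_{\min}<0$; $\eta(q)=\lambda_1$ if $q_{\max}<0$, $4$ if $q_{\max}\ge0$; $\xi(q)=\lambda_1$ if $q_{\min}\ge0$, $4$ if $q_{\min}<0$. $\alpha_1=\eta(q)q_{\max}-\eta'(p)p_{\min}$, $\alpha_2=\xi(q)q_{\min}-16p_{\max}$. *)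

(* Defs.v *)
From HB Require Import structures.
From mathcomp Require Import all_boot all_order all_algebra.
From mathcomp Require Import all_classical all_reals all_analysis.
Set Implicit Arguments.
Unset Strict Implicit.
Unset Printing Implicit Defensive.
Import Order.TTheory GRing.Theory Num.Theory.
Import numFieldNormedType.Exports.
Local Open Scope ring_scope.

Section Defs.
Variable R : realType.

Definition Delta (x : int -> R) : int -> R := fun k => x (k + 1) - x k.
Definition Delta2 (x : int -> R) : int -> R := Delta (Delta x).

Definition bvp_lhs (p q : int -> R) (f : int -> R -> R) (y : int -> R) (k : int) : R :=
  Delta2 (fun j => p j * Delta2 y (j - 2)) k
  + Delta (fun j => q j * Delta y (j - 1)) k
  + f k (y k).

(* y (viewed on Z[-1,N+2]) solves the BVP *)
Definition is_solution (N : nat) (p q : int -> R) (f : int -> R -> R) (y : int -> R) : Prop :=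
  (forall k : int, 1 <= k <= N%:Z -> bvp_lhs p q f y k = 0)
  /\ y (-1) = 0 /\ y 0 = 0 /\ y (N%:Z + 1) = 0 /\ y (N%:Z + 2) = 0.

Definition pmin (N : nat) (p : int -> R) : R :=
  \big[Num.min/p 1]_(i < N.+2) p (i.+1)%:Z.
Definition pmax (N : nat) (p : int -> R) : R :=
  \big[Num.max/p 1]_(i < N.+2) p (i.+1)%:Z.
Definition qmin (N : nat) (q : int -> R) : R :=
  \big[Num.min/q 1]_(i < N.+1) q (i.+1)%:Z.
Definition qmax (N : nat) (q : int -> R) : R :=
  \big[Num.max/q 1]_(i < N.+1) q (i.+1)%:Z.

(* the element of E with ytilde = v : extension by zero outside Z[1,N] *)
Definition extE (N : nat) (v : 'cV[R]_N) : int -> R :=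
  fun k => \sum_(j < N) (if k == (j.+1)%:Z then v j 0 else 0).

(* V : (N+1) x N with V ytilde = (Delta y(0), ..., Delta y(N)) *)
Definition Vmx (N : nat) : 'M[R]_(N.+1, N) :=
  \matrix_(i < N.+1, j < N) Delta (extE (delta_mx j 0)) (i%:Z).
(* W : (N+2) x N with W ytilde = (Delta^2 y(-1), ..., Delta^2 y(N)) *)
Definition Wmx (N : nat) : 'M[R]_(N.+2, N) :=
  \matrix_(i < N.+2, j < N) Delta2 (extE (delta_mx j 0)) (i%:Z - 1).

Definition lambda_min (N : nat) (A : 'M[R]_N) : R := inf [set a : R | eigenvalue A a].

Definition lambda1 (N : nat) : R := lambda_min ((Vmx N)^T *m Vmx N).
Definition lambda2 (N : nat) : R := lambda_min ((Wmx N)^T *m Wmx N).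

Definition eta' (N : nat) (p : int -> R) : R :=
  if 0 <= pmin N p then lambda2 N else 16.
Definition eta (N : nat) (q : int -> R) : R :=
  if qmax N q < 0 then lambda1 N else 4.
Definition xi (N : nat) (q : int -> R) : R :=
  if 0 <= qmin N q then lambda1 N else 4.

Definition alpha1 (N : nat) (p q : int -> R) : R :=
  eta N q * qmax N q - eta' N p * pmin N p.
Definition alpha2 (N : nat) (p q : int -> R) : R :=
  xi N q * qmin N q - 16 * pmax N p.

End Defs.

(* Main.v *)
Require Import Defs.
From HB Require Import structures.
From mathcomp Require Import all_boot all_order all_algebra.
From mathcomp Require Import all_classical all_reals all_analysis.
From mathcomp Require Import zify ring lra.
Import Order.TTheory GRing.Theory Num.Theory.
Import numFieldNormedType.Exports.
Set Implicit Arguments.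
Unset Strict Implicit.
Unset Printing Implicit Defensive.
Local Open Scope classical_set_scope.
Local Open Scope ring_scope.

(** The solutions are the critical points of the even energy
    [J y = 1/2 sum p (Delta2 y)^2 - 1/2 sum q (Delta y)^2 + sum F_k (y k)],
    with [F_k] the even primitive of [f k].  By (2) the energy is coercive and by
    (3) it is negative on small spheres, so it has [N] pairs of critical points at
    negative levels (Clark's theorem).

    Suppose there were only [m < N] such pairs [x, - x].  A discrete gradient descent
    started on a small l1-sphere comes near one of them; labelling the starting point
    by the pair and the sign yields an odd labelling by [+-1, ..., +-m].  Tucker's
    lemma gives two arbitrarily close starting points with opposite labels: a
    descent then travels from near [x] to near [- x], two points of equal
    energy, while crossing an annulus where the gradient is bounded away from 0
    and thus losing a fixed amount of energy. *)

(** * Simplicial chains modulo 2 and alternating labels *)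

(** The l1-sphere is used because it is the boundary of a cross-polytope: it has an antipodally
    symmetric triangulation, and barycentric subdivisions of its flat faces stay on it. Its top
    simplices have [N] vertices, and an alternating labelling of one of them needs [N] different
    pairs; this is where the number [N] comes from. The obstacle is that the end of a descent
    depends discontinuously on its start, since nearby starts may stop at different times. Only the
    orbit that runs longer is followed: at the earlier stopping time the two orbits are still close,
    and from there the longer one must cross the annulus. This needs a bound on the number of steps
    that is uniform in the start. The thresholds are bounds for the quadratic part: [- alpha1]
    bounds its Rayleigh quotient from below and [- alpha2] from above. Hence (2) lets the nonlinear
    term outweigh the quadratic part far out, and (3) lets the quadratic part win near 0. Zero
    itself is never counted, as [J 0 = 0]; so each critical point found differs from its
    negative. *)

Fixpoint faces (T : Type) (s : seq T) : seq (seq T) :=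
  if s is x :: s' then s' :: [seq x :: t | t <- faces s'] else [::].

Lemma faces_map (T U : Type) (g : T -> U) s :
  faces (map g s) = map (map g) (faces s).
Proof. by elim: s => //= x s ->; rewrite -!map_comp. Qed.

(** A chain is a list of simplices, with repetitions as multiplicities. Mod 2 it is seen only
    through its pairings with cochains [phi], so cancellations never have to be carried out on
    lists. *)
Definition eval2 (T : Type) (phi : T -> bool) (c : seq T) : bool :=
  \big[addb/false]_(s <- c) phi s.

Lemma eval2_map (T U : Type) phi (g : T -> U) c :
  eval2 phi (map g c) = eval2 (phi \o g) c.
Proof. by rewrite /eval2 big_map. Qed.

Section Chains.
Variable T : Type.
Implicit Types (s : seq T) (c : seq (seq T)) (phi : seq T -> bool).

Definition linext (F : seq T -> seq (seq T)) c := flatten [seq F s | s <- c].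

Lemma eval2_linext phi F c :
  eval2 phi (linext F c) = eval2 (fun s => eval2 phi (F s)) c.
Proof. by rewrite /eval2 /linext big_flatten big_map. Qed.

Lemma eval2_cat phi c1 c2 : eval2 phi (c1 ++ c2) = eval2 phi c1 (+) eval2 phi c2.
Proof. by rewrite /eval2 big_cat. Qed.

Lemma eval2D phi1 phi2 c :
  eval2 (fun s => phi1 s (+) phi2 s) c = eval2 phi1 c (+) eval2 phi2 c.
Proof. by rewrite /eval2 big_split. Qed.

Lemma eq_eval2 phi1 phi2 c : phi1 =1 phi2 -> eval2 phi1 c = eval2 phi2 c.
Proof. by move=> e; apply: eq_bigr => s _; apply: e. Qed.

Lemma linext_cat F c1 c2 : linext F (c1 ++ c2) = linext F c1 ++ linext F c2.
Proof. by rewrite /linext map_cat flatten_cat. Qed.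

(** The cone formula ∂(b * c) = c + b * ∂c. It has no exception in dimension 0, because the empty
    simplex counts as the face of a vertex. *)
Lemma eval2_faces_cone phi b c :
  eval2 phi (linext (@faces T) (map (cons b) c)) =
  eval2 phi c (+) eval2 (phi \o cons b) (linext (@faces T) c).
Proof.
rewrite !eval2_linext eval2_map -eval2D; apply: eq_eval2 => s /=.
by rewrite /eval2 big_cons big_map.
Qed.

Lemma eval2_faces_faces phi s : eval2 phi (linext (@faces T) (faces s)) = false.
Proof.
elim: s phi => [|x s IH] phi; first by rewrite /linext /eval2 big_nil.
rewrite /= -cat1s linext_cat eval2_cat eval2_faces_cone IH addbF.
by rewrite /linext /= cats0 addbb.
Qed.

Definition chain_eq c1 c2 := forall phi, eval2 phi c1 = eval2 phi c2.

Lemma chain_eq_linext F c1 c2 :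
  chain_eq c1 c2 -> chain_eq (linext F c1) (linext F c2).
Proof. by move=> e phi; rewrite !eval2_linext. Qed.

Lemma size_faces s n : size s = n.+1 -> all (fun t => size t == n) (faces s).
Proof.
elim: s n => [|x s IH] n //= [sn]; rewrite sn eqxx /= all_map.
case: n sn => [|n] sn; first by rewrite (size0nil sn).
by apply: sub_all (IH _ sn) => t.
Qed.

Variable bary : seq T -> T.


(** The fuel [n] is always the size of [s], since faces are not structural subterms. *)
Fixpoint subdiv_rec n s : seq (seq T) :=
  if n is n'.+1 then map (cons (bary s)) (linext (subdiv_rec n') (faces s))
  else [:: s].

Definition subdiv s := subdiv_rec (size s) s.

Lemma subdiv_cons x s :
  subdiv (x :: s) = map (cons (bary (x :: s))) (linext subdiv (faces (x :: s))).
Proof.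
rewrite {1}/subdiv; set t := x :: s.
rewrite [LHS]/=; congr (map _ _).
transitivity (flatten (map (subdiv_rec (size s)) (faces t))) => //.
rewrite /linext; congr (flatten _).
have := size_faces (erefl (size t)).
elim: (faces t) => //= u r IH /andP[/eqP su /IH ->].
by rewrite /subdiv su.
Qed.

(** Subdivision is a chain map, by induction on the dimension: the cone formula gives ∂ Sd s = Sd ∂s
    + b * ∂ Sd ∂s, and by induction ∂ Sd ∂s = Sd ∂∂s = 0. *)
Lemma faces_subdiv c :
  chain_eq (linext (@faces T) (linext subdiv c)) (linext subdiv (linext (@faces T) c)).
Proof.
move=> phi; rewrite !eval2_linext.
pose n := \max_(s <- c) size s.
have : all (fun s => size s <= n)%N c.
  rewrite /n; elim: c {n} => //= s c IH; rewrite big_cons leq_maxl /=.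
  by apply: sub_all IH => t h; apply: leq_trans h (leq_maxr _ _).
suff key s : (size s <= n)%N ->
    eval2 phi (linext (@faces T) (subdiv s)) = eval2 phi (linext subdiv (faces s)).
  clearbody n; elim: c => [|s c IH] /=; rewrite /eval2 ?big_nil // !big_cons.
  move=> /andP[sn cn]; congr addb; last exact: IH.
  by rewrite -!/(eval2 _ _) -!eval2_linext; exact: key.
clearbody n; elim: n s phi => [|n IH] [|x s] phi //; try by rewrite /eval2 !big_nil.
move=> sn; rewrite subdiv_cons eval2_faces_cone.
set X := faces (x :: s).
suff -> : forall psi, eval2 psi (linext (@faces T) (linext subdiv X)) = false.
  by rewrite addbF.
move=> psi; transitivity (eval2 psi (linext subdiv (linext (@faces T) X))).
  have : all (fun s => size s <= n)%N X.
    by apply: sub_all (@size_faces (x :: s) (size s) erefl) => t /eqP ->.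
  rewrite !eval2_linext; elim: X => [|t X IHX] /=; rewrite /eval2 ?big_nil // !big_cons.
  move=> /andP[tn Xn]; congr addb; last exact: IHX.
  by rewrite -!/(eval2 _ _) -!eval2_linext; exact: IH.
by rewrite eval2_linext eval2_faces_faces.
Qed.

Lemma faces_iter_subdiv M c :
  chain_eq (linext (@faces T) (iter M (linext subdiv) c))
           (iter M (linext subdiv) (linext (@faces T) c)).
Proof.
elim: M c => //= M IH c phi; rewrite faces_subdiv.
exact: (chain_eq_linext _ (IH c)).
Qed.

Lemma iter_subdiv_nil M : iter M (linext subdiv) [:: [::]] = [:: [::]].
Proof. by elim: M => //= M ->. Qed.

Lemma iter_linext_cat F M c1 c2 :
  iter M (linext F) (c1 ++ c2) = iter M (linext F) c1 ++ iter M (linext F) c2.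
Proof. by elim: M => //= M ->; rewrite linext_cat. Qed.

Lemma chain_eq_iter F M c1 c2 :
  chain_eq c1 c2 -> chain_eq (iter M (linext F) c1) (iter M (linext F) c2).
Proof. by move=> e; elim: M => //= M IH; apply: chain_eq_linext. Qed.

Section Equivariance.
Variable g : T -> T.
Hypothesis bary_map : forall s, bary (map g s) = g (bary s).

Lemma subdiv_map s : subdiv (map g s) = map (map g) (subdiv s).
Proof.
rewrite /subdiv size_map; move: (size s) => n; elim: n s => //= n IH s.
have E c : linext (subdiv_rec n) (map (map g) c) =
           map (map g) (linext (subdiv_rec n) c).
  rewrite /linext map_flatten -!map_comp; congr (flatten _).
  by apply: eq_map => t /=; rewrite IH.
by rewrite bary_map faces_map E -!map_comp.
Qed.

Lemma iter_subdiv_map M c :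
  iter M (linext subdiv) (map (map g) c) = map (map g) (iter M (linext subdiv) c).
Proof.
elim: M => //= M ->; rewrite /linext map_flatten -!map_comp.
by congr (flatten _); apply: eq_map => t /=; rewrite subdiv_map.
Qed.
End Equivariance.
End Chains.

Section EqChains.
Variables (T : eqType) (bary : seq T -> T).

Lemma mem_faces (s t : seq T) : t \in faces s -> {subset t <= s}.
Proof.
elim: s t => //= x s IH t; rewrite inE => /predU1P[-> y ys|].
  by rewrite inE ys orbT.
case/mapP => u us -> y; rewrite !inE => /predU1P[->|yu]; first by rewrite eqxx.
by rewrite (IH _ us _ yu) orbT.
Qed.

Lemma eq_in_eval2 (phi1 phi2 : seq T -> bool) c :
  {in c, phi1 =1 phi2} -> eval2 phi1 c = eval2 phi2 c.
Proof. by move=> e; rewrite /eval2 big_seq [RHS]big_seq; apply: eq_bigr. Qed.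

Lemma subdiv_closed (C : T -> Prop) :
  (forall s, s != [::] -> {in s, forall x, C x} -> C (bary s)) ->
  forall s, {in s, forall x, C x} ->
  forall t, t \in subdiv bary s -> {in t, forall x, C x}.
Proof.
move=> Cb s; rewrite /subdiv; move: (size s) => n; elim: n s => [|n IH] s Cs t /=.
  by rewrite inE => /eqP ->.
case/mapP => u /flatten_mapP[v vs uv] -> x; rewrite inE => /predU1P[->|].
  by apply: Cb => //; apply: contraTneq vs => ->.
apply: IH uv x => y yv; exact: Cs (mem_faces vs yv).
Qed.

Lemma subdiv_size s t : t \in subdiv bary s -> size t = size s.
Proof.
rewrite /subdiv; have [k sk] : exists k, size s = k by exists (size s).
rewrite sk; move: sk.
elim: k s t => [|k IH] s t sk /=; first by rewrite inE => /eqP ->.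
case/mapP => u /flatten_mapP[v vs uv] -> /=; congr S; rewrite (IH v) //.
by have /allP/(_ _ vs)/eqP := size_faces sk.
Qed.

Lemma subdiv_iter_ind (P : seq T -> Prop) c :
  (forall s, P s -> forall t, t \in subdiv bary s -> P t) ->
  {in c, forall s, P s} -> forall M, {in iter M (linext (subdiv bary)) c, forall s, P s}.
Proof.
move=> Ps Pc; elim=> //= M IH s /flatten_mapP[t tc st].
exact: Ps (IH _ tc) _ st.
Qed.

(** [rem x s] deletes the first occurrence of [x], so with repeated entries it is only a permutation
    of the intended face; hence the symmetry required of [phi]. The right-hand side makes the count
    insensitive to sorting. *)
Lemma eval2_faces_rem (phi : seq T -> bool) s :
  (forall t1 t2, perm_eq t1 t2 -> phi t1 = phi t2) ->
  eval2 phi (faces s) = \big[addb/false]_(x <- s) phi (rem x s).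
Proof.
elim: s phi => [|x s IH] phi phiP; first by rewrite /eval2 !big_nil.
rewrite /= big_cons eqxx -cat1s eval2_cat eval2_map IH; last first.
  by move=> t1 t2 t12; apply: phiP; rewrite perm_cons.
rewrite {1}/eval2 big_seq1; congr addb; rewrite big_seq [RHS]big_seq.
apply: eq_bigr => y ys /=; case: eqP => //= xy; apply: phiP.
by rewrite xy perm_sym perm_to_rem.
Qed.

Lemma eval2_faces_perm (phi : seq T -> bool) s1 s2 :
  (forall t1 t2, perm_eq t1 t2 -> phi t1 = phi t2) ->
  perm_eq s1 s2 -> eval2 phi (faces s1) = eval2 phi (faces s2).
Proof.
move=> phiP s12; rewrite !eval2_faces_rem // (perm_big _ s12).
rewrite big_seq [RHS]big_seq; apply: eq_bigr => x xs2; apply: phiP.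
have xs1 : x \in s1 by rewrite (perm_mem s12).
rewrite -(perm_cons x); apply: perm_trans (perm_to_rem xs2).
by apply: perm_trans s12; rewrite perm_sym; exact: perm_to_rem.
Qed.
End EqChains.

(** * Signed labels and Ky Fan's alternating simplices *)

Section Labels.
Implicit Types (L : seq nat) (b : bool).

Fixpoint alternates b (s : seq bool) :=
  if s is x :: s' then (x == b) && alternates (~~ b) s' else true.

(** If [s] alternates, only deleting its first or its last entry leaves an alternating list, and
    exactly one of these faces starts with [b]. If [s] does not alternate but some face does, then
    [s] has a single pair of equal neighbours, and deleting either one gives the same face: an even
    count. *)
Lemma alternates_faces b s : s != [::] ->
  eval2 (alternates b) (faces s) = alternates true s (+) alternates false s.
Proof.
elim: s b => // x s IH b _.
rewrite [faces _]/= -cat1s eval2_cat eval2_map {1}/eval2 big_seq1.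
have -> : eval2 (alternates b \o cons x) (faces s) =
          (x == b) && eval2 (alternates (~~ b)) (faces s).
  rewrite /eval2; case xb: (x == b) => /=.
    by apply: eq_bigr => t _ /=; rewrite xb.
  by rewrite big1 // => t _ /=; rewrite xb.
case: s IH => [|y s] IH; first by rewrite /eval2 big_nil; case: x b => [] [].
rewrite IH //; move: (y :: s) => u /=.
by case: x; case: b; case: (alternates true u); case: (alternates false u).
Qed.

(* A signed label (j, sign) is encoded as the number 2 j + sign. *)
Definition flip (c : nat) : nat := ~~ odd c + c./2.*2.

(** This expresses the absence of complementary edges. *)
Definition consistent L := {in L &, forall c d, c./2 = d./2 -> c = d}.

(** Sorting by code sorts by absolute label; the sign bit decides only between a label and its
    negative, which [consistent] forbids together. *)
Definition altlab b L := alternates b (map odd (sort leq L)).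

Lemma altlab_faces b L : L != [::] ->
  eval2 (altlab b) (faces L) = altlab true L (+) altlab false L.
Proof.
move=> L0; have altP t1 t2 : perm_eq t1 t2 -> altlab b t1 = altlab b t2.
  move=> t12; rewrite /altlab; congr alternates; congr map.
  by apply/perm_sortP => //; [exact: leq_total|exact: leq_trans|exact: anti_leq].
rewrite (@eval2_faces_perm _ _ _ (sort leq L)) //; last by rewrite perm_sym perm_sort.
rewrite /altlab -(alternates_faces b); last first.
  by rewrite -size_eq0 size_map size_sort size_eq0.
rewrite faces_map eval2_map; apply: eq_in_eval2 => t tL /=; congr alternates.
congr map; apply: (sorted_sort leq_trans).
(* Deleting an entry of a sorted list leaves it sorted, so the faces need no further sorting. *)
have : sorted leq (sort leq L) by apply: sort_sorted; exact: leq_total.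
elim: (sort leq L) t tL => //= x s IH t.
rewrite inE => /predU1P[->|/mapP[u us ->]] xs; first exact: path_sorted xs.
rewrite /= path_min_sorted; first exact: IH us (path_sorted xs).
apply/allP => y yu; move: xs; rewrite path_sortedE; last exact: leq_trans.
by case/andP => /allP xs _; apply: xs; exact: mem_faces us _ yu.
Qed.

Lemma odd_flip c : odd (flip c) = ~~ odd c.
Proof. by rewrite /flip oddD odd_double addbF oddb. Qed.

(** Flipping could only disturb the order of [2 j] and [2 j + 1]; consistency excludes that both
    occur, so sorting commutes with [flip]. *)
Lemma altlab_flip b L : consistent L -> altlab b (map flip L) = altlab (~~ b) L.
Proof.
move=> cL; rewrite /altlab.
have -> : sort leq (map flip L) = map flip (sort leq L).
  apply: (sorted_eq leq_trans anti_leq); first by apply: sort_sorted; exact: leq_total.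
    have : sorted leq (sort leq L) by apply: sort_sorted; exact: leq_total.
    have {}cL : consistent (sort leq L) by move=> x y; rewrite !mem_sort; exact: cL.
    rewrite sorted_map; apply: sub_in_sorted (allss _) => x y xL yL /= xy.
    have [e|ne] := eqVneq x./2 y./2; first by rewrite (cL _ _ xL yL e).
    have : (x./2 < y./2)%N by rewrite ltn_neqAle ne half_leq.
    by rewrite /flip; lia.
  rewrite perm_sort perm_sym; apply: perm_map; exact: permEl (perm_sort _ _).
rewrite -map_comp (@eq_map _ _ (odd \o flip) (negb \o odd)); last first.
  by move=> c /=; rewrite odd_flip.
rewrite map_comp; elim: (map odd _) b => //= x s IH b.
by rewrite IH; case: x b => [] [].
Qed.

(** Neighbours in the sorted list with the same absolute label would, by consistency, have the same
    sign, contrary to alternation. So the absolute labels are distinct numbers below [m]. *)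
Lemma altlab_size m b L : consistent L -> {in L, forall c, (c./2 < m)%N} ->
  altlab b L -> (size L <= m)%N.
Proof.
move=> cL Lm; rewrite /altlab -(size_sort leq L).
have := sort_sorted leq_total L.
have {}cL : consistent (sort leq L) by move=> x y; rewrite !mem_sort; exact: cL.
have {}Lm : {in sort leq L, forall c, (c./2 < m)%N}.
  by move=> c; rewrite mem_sort; exact: Lm.
move: (sort leq L) cL Lm => M cM Mm sM aM.
suff : sorted ltn (map half M).
  move=> /(sorted_uniq ltn_trans ltnn) uM.
  rewrite -(size_map half M) -(size_iota 0 m); apply: uniq_leq_size => // ?.
  by case/mapP => c cM' ->; rewrite mem_iota /= add0n Mm.
elim: M b cM {Mm} sM aM => //= x [|y s] IH b cM //= /andP[xy sM].
move=> /and3P[/eqP ox /eqP oy aM].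
apply/andP; split; last first.
  apply: (IH (~~ b)) => //=; last by rewrite oy eqxx.
  by move=> u v us vs; apply: cM; rewrite inE ?us ?vs orbT.
rewrite ltn_neqAle half_leq // andbT; apply/eqP => e.
have := cM x y; rewrite !inE !eqxx orbT /= => /(_ isT isT e) E.
by move: ox oy; rewrite E => ->; case: b {aM IH}.
Qed.
End Labels.

(** * Tucker's lemma *)

Section Barycentres.
Variables (R : realType) (V : normedModType R).
Implicit Types (s t : seq V) (b x : V).

Definition bary s : V := (size s)%:R^-1 *: \sum_(x <- s) x.

Lemma bary_opp s : bary (map -%R s) = - bary s.
Proof. by rewrite /bary size_map big_map sumrN scalerN. Qed.

Lemma sumr_const_seq (U : zmodType) (T : Type) (r : seq T) (u : U) :
  \sum_(i <- r) u = u *+ size r.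
Proof. by rewrite big_const_seq count_predT iter_addr_0. Qed.

Lemma baryB s b : s != [::] ->
  bary s - b = (size s)%:R^-1 *: \sum_(x <- s) (x - b).
Proof.
move=> s0; rewrite big_split /= scalerDr sumr_const_seq; congr (_ + _).
by rewrite mulNrn scalerN -[b *+ _]scaler_nat scalerA mulVf ?scale1r // pnatr_eq0 size_eq0.
Qed.

Lemma norm_bary_le s b (r : R) : s != [::] ->
  {in s, forall x, `|x - b| <= r} -> `|bary s - b| <= r.
Proof.
move=> s0 sr; rewrite baryB // normrZ ger0_norm ?invr_ge0 //.
rewrite ler_pdivrMl ?ltr0n ?lt0n ?size_eq0 //.
apply: le_trans (ler_norm_sum _ _ _) _.
rewrite mulrC mulr_natr -sumr_const_seq big_seq [leRHS]big_seq.
exact: ler_sum.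
Qed.

Definition diam_le (D : R) s := {in s &, forall x y, `|x - y| <= D}.

(** In the mean of the differences with [x] the term of [x] itself vanishes, which leaves at most
    the fraction 1 - 1/|s| of [D]. *)
Lemma norm_bary_vertex n (D : R) s x : diam_le D s -> (size s <= n)%N ->
  x \in s -> `|bary s - x| <= (1 - n%:R^-1) * D.
Proof.
move=> sD sn xs; have s0 : s != [::] by apply: contraTneq xs => ->.
have sz : (0 < size s)%N by rewrite lt0n size_eq0.
have D0 : 0 <= D by apply: le_trans (sD _ _ xs xs).
rewrite baryB // normrZ ger0_norm ?invr_ge0 //.
rewrite (perm_big _ (perm_to_rem xs)) big_cons /= (subrr x) add0r.
apply: (@le_trans _ _ ((size s)%:R^-1 * (D *+ (size s).-1))).
  rewrite ler_wpM2l ?invr_ge0 //; apply: le_trans (ler_norm_sum _ _ _) _.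
  rewrite -(size_rem xs) -sumr_const_seq.
  rewrite big_seq [leRHS]big_seq; apply: ler_sum => y /mem_rem ys.
  exact: sD.
rewrite -[D *+ _]mulr_natl mulrA ler_wpM2r //.
rewrite -subn1 natrB // mulrBr mulVf ?pnatr_eq0 -?lt0n // mulr1 lerB //.
by rewrite lef_pV2 ?posrE ?ltr0n ?ler_nat // (leq_trans sz).
Qed.

Lemma subdiv_diam n (D : R) s t : (size s <= n)%N -> diam_le D s ->
  t \in subdiv bary s -> diam_le ((1 - n%:R^-1) * D) t.
Proof.
rewrite /subdiv; have [k sk] : exists k, size s = k by exists (size s).
rewrite sk; elim: k s t sk => [|k IH] s t sk sn sD /=.
  by rewrite inE (size0nil sk) => /eqP ->.
case/mapP => u /flatten_mapP[v vs uv] ->.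
have vk : size v = k by have /allP/(_ _ vs)/eqP := size_faces sk.
have vD : diam_le D v by move=> x y xv yv; apply: sD; exact: mem_faces vs _ _.
have s0 : s != [::] by rewrite -size_eq0 sk.
(* The vertices of the subdivided face remain in every ball that contains the vertices of the face,
   here one centred at the barycentre of [s]. *)
have bu y : y \in u -> `|bary s - y| <= (1 - n%:R^-1) * D.
  move=> yu; rewrite distrC.
  suff : {in u, forall y, `|y - bary s| <= (1 - n%:R^-1) * D} by apply.
  rewrite -vk in uv; apply: (subdiv_closed _ _ uv) => [w w0 wP|z zv].
    exact: norm_bary_le.
  by rewrite distrC; apply: norm_bary_vertex; rewrite ?sk // (mem_faces vs).
have uD := IH v u vk (ltnW sn) vD uv.
have x0 : 0 <= (1 - n%:R^-1) * D.
  case: s s0 {sk vs bu} sn sD => // x s _ sn sD; apply: mulr_ge0.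
    by rewrite subr_ge0 invf_le1 ?ltr0n ?ler1n (leq_ltn_trans _ sn).
  by apply: le_trans (sD x x _ _) => //; rewrite inE eqxx.
move=> x y; rewrite !inE => /predU1P[->|xu] /predU1P[->|yu].
- by rewrite subrr normr0.
- exact: bu.
- by rewrite distrC; exact: bu.
- exact: uD.
Qed.

(** The boundary of the cross-polytope on the points ± e_0, ..., ± e_(k-1), built by repeated
    suspension. *)
Fixpoint cross (e : nat -> V) k : seq (seq V) :=
  if k is k'.+1 then map (cons (e k')) (cross e k') ++ map (cons (- e k')) (cross e k')
  else [:: [::]].

Lemma cross_opp e k : chain_eq (map (map -%R) (cross e k)) (cross e k).
Proof.
elim: k => //= k IH phi; rewrite map_cat !eval2_cat -!map_comp addbC.
congr addb; rewrite !eval2_map -[RHS]IH eval2_map; apply: eq_eval2 => s //=.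
by rewrite opprK.
Qed.

Lemma cross_cycle e k : chain_eq (linext (@faces V) (cross e k)) [::].
Proof.
move=> phi; elim: k phi => // k IH phi.
rewrite [cross _ _]/= linext_cat eval2_cat !eval2_faces_cone !IH /eval2 !big_nil !addbF.
exact: addbb.
Qed.

Lemma cross_size e k : {in cross e k, forall s, size s = k}.
Proof.
elim: k => [|k IH] s /=; first by rewrite inE => /eqP ->.
by rewrite mem_cat => /orP[] /mapP[t /IH tk ->] /=; rewrite tk.
Qed.

Local Notation sdn M := (iter M (linext (subdiv bary))).

Lemma sdn_size e k M : {in sdn M (cross e k), forall s, size s = k}.
Proof.
apply: subdiv_iter_ind (@cross_size e k) M => s sk t /subdiv_size.
by rewrite sk.
Qed.

(* Ky Fan's parity count: passing from [cross k] to its half [e_k * cross k],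
   whose boundary is [cross k], preserves the number mod 2 of simplices with
   alternating labels. *)
Lemma alternating_parity e (code : V -> nat) M n :
  (forall k, (k <= n)%N -> {in sdn M (cross e k), forall t,
     consistent (map code t) /\ {in t, forall x, code (- x) = flip (code x)}}) ->
  forall k, (k <= n)%N -> eval2 (altlab true \o map code) (sdn M (cross e k)) = true.
Proof.
move=> good; elim=> [_|k IH kn].
  by rewrite /= iter_subdiv_nil /eval2 big_seq1.
rewrite [cross e _]/= iter_linext_cat eval2_cat.
set H := map (cons (e k)) _.
have Hgood t : t \in sdn M H -> [/\ consistent (map code t),
    {in t, forall x, code (- x) = flip (code x)} & t != [::]].
  move=> tH; have tc : t \in sdn M (cross e k.+1).
    by rewrite /= iter_linext_cat mem_cat tH.
  by have [? ?] := good _ kn _ tc; rewrite -size_eq0 (sdn_size tc).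
(* The other half is the antipode of [H], since [cross e k] is symmetric mod 2. The antipode flips
   all labels, so its positive alternating simplices correspond to the negative ones of [H]. *)
have -> : eval2 (altlab true \o map code) (sdn M (map (cons (- e k)) (cross e k)))
        = eval2 (altlab false \o map code) (sdn M H).
  transitivity (eval2 (altlab true \o map code) (sdn M (map (map -%R) H))).
    apply: chain_eq_iter => phi; rewrite /H -map_comp !eval2_map.
    rewrite -[LHS]cross_opp eval2_map; exact: eq_eval2.
  rewrite iter_subdiv_map; last exact: bary_opp.
  rewrite eval2_map; apply: eq_in_eval2 => t tH /=.
  have [ct ft _] := Hgood _ tH; rewrite -[false]/(~~ true) -altlab_flip //.
  congr altlab; rewrite -!map_comp; apply/eq_in_map => x xt /=; exact: ft.
rewrite -eval2D; apply: etrans (IH (ltnW kn)).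
(* Positive plus negative alternating simplices of [H] are counted by the alternating faces;
   interior faces cancel mod 2, and the boundary of [H] is [cross e k] because the latter is a
   cycle. *)
transitivity (eval2 (altlab true \o map code) (linext (@faces V) (sdn M H))).
  rewrite eval2_linext; apply: eq_in_eval2 => t /Hgood[ct _ t0].
  rewrite /= -(eval2_map (altlab true) (map code)) -faces_map altlab_faces //.
  by rewrite -size_eq0 size_map size_eq0.
rewrite faces_iter_subdiv; apply: chain_eq_iter => phi.
by rewrite /H eval2_faces_cone cross_cycle /eval2 big_nil addbF.
Qed.
End Barycentres.

Section Tucker.
Variables (R : realType) (n : nat).
Local Notation V := 'rV[R]_n.+1.

Definition l1norm (y : V) : R := \sum_i `|y 0 i|.

Lemma norm_le_l1 (y : V) : `|y| <= l1norm y.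
Proof.
rewrite [leLHS]/Num.norm /= mx_normrE; apply: bigmax_le => [|[i j] _] /=.
  exact: sumr_ge0.
by rewrite ord1 /l1norm (bigD1 j) //= lerDl sumr_ge0.
Qed.

(** Without such a pair, a subdivision of mesh below [tau] has no complementary edge, and the parity
    count yields an alternating simplex with [n.+1] vertices. Its absolute labels would be [n.+1]
    distinct numbers below [m]. *)
Lemma tucker (rho tau : R) (m : nat) (lab : V -> nat) (sg : V -> bool) :
  0 < rho -> 0 < tau -> (m < n.+1)%N ->
  (forall y, l1norm y = rho -> (lab y < m)%N) ->
  (forall y, l1norm y = rho -> lab (- y) = lab y /\ sg (- y) = ~~ sg y) ->
  exists y z, [/\ l1norm y = rho, l1norm z = rho, `|y - z| < tau,
                  lab y = lab z & sg y != sg z].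
Proof.
move=> rho0 tau0 mn labm labN; apply: contrapT => noedge.
pose e (k : nat) : V := rho *: delta_mx 0 (inord k).
pose D : R := 2 * rho.
pose code (y : V) : nat := (sg y + (lab y).*2)%N.
pose kap : R := 1 - n.+1%:R^-1.
(* [kap] is the factor by which one subdivision shrinks the mesh of simplices with at most [n.+1]
   vertices. *)
have kap0 : 0 <= kap by rewrite subr_ge0 invf_le1 ?ltr0n ?ler1n.
have kap1 : kap < 1 by rewrite ltrBlDr ltrDl invr_gt0 ltr0n.
have [M Mtau] : exists M, kap ^+ M * D < tau.
  have D0 : 0 < D by rewrite mulr_gt0.
  have /cvg_expr/cvgrPdist_lt/(_ (tau / D)) : `|kap| < 1 by rewrite ger0_norm.
  rewrite divr_gt0 // => /(_ isT)[M _ /(_ M (leqnn M))] /=.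
  rewrite sub0r normrN ger0_norm ?exprn_ge0 // => MD.
  by exists M; rewrite -ltr_pdivlMr.
(* All vertices lie in one closed face of the cross-polytope, given by the signs [eps]. On it the
   l1-norm is affine, so barycentres keep norm [rho]. *)
pose onface (s : seq V) := exists eps : 'I_n.+1 -> bool, {in s, forall y : V,
  (forall i, 0 <= (-1) ^+ eps i * y 0 i) /\ \sum_i (-1) ^+ eps i * y 0 i = rho}.
have onface_l1 s : onface s -> {in s, forall y, l1norm y = rho}.
  move=> [eps h] y /h[h0 <-]; apply: eq_bigr => i _.
  by rewrite -(ger0_norm (h0 i)) normrMsign.
have face_sub s t : onface s -> t \in subdiv (@bary R V) s -> onface t.
  move=> [eps sP] tP; exists eps.
  apply: (subdiv_closed _ sP tP) => u u0 uP.
  have E i : (-1) ^+ eps i * bary u 0 i =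
             (size u)%:R^-1 * \sum_(x <- u) (-1) ^+ eps i * x 0 i.
    by rewrite /bary mxE summxE mulrCA mulr_sumr.
  split=> [i|].
    rewrite E mulr_ge0 ?invr_ge0 // big_seq; apply: sumr_ge0 => x /uP[+ _].
    exact.
  rewrite (eq_bigr _ (fun i _ => E i)) -mulr_sumr exchange_big /=.
  rewrite big_seq (eq_bigr (fun=> rho)); last by move=> x /uP[].
  rewrite -big_seq sumr_const_seq -[rho *+ _]mulr_natl mulKf //.
  by rewrite pnatr_eq0 size_eq0.
have face_cross k : (k <= n.+1)%N -> {in cross e k, forall s, onface s}.
  move=> kn s sk.
  suff [eps epsP] : exists eps : nat -> bool, {in s, forall y : V,
      exists2 j, (j < k)%N & y = (-1) ^+ eps j *: e j}.
    exists (fun i : 'I_n.+1 => eps i) => y /epsP[j jk ->].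
    have E (i : 'I_n.+1) : (-1) ^+ eps i * ((-1) ^+ eps j *: e j) 0 i =
        if i == inord j then rho else 0.
      rewrite !mxE eqxx /=; case: eqP => [->|_]; last by rewrite !mulr0.
      by rewrite inordK ?(leq_trans jk) // mulrA -signr_addb addbb mul1r mulr1.
    split=> [i|]; first by rewrite E; case: ifP => // _; exact: ltW.
    by rewrite (eq_bigr _ (fun i _ => E i)) -big_mkcond big_pred1_eq.
  elim: k s sk {kn} => [|k IH] s /=.
    by rewrite inE => /eqP ->; exists (fun=> false).
  have key (b : bool) t : t \in cross e k -> exists eps : nat -> bool,
     {in ((-1) ^+ b *: e k) :: t, forall y : V,
       exists2 j, (j < k.+1)%N & y = (-1) ^+ eps j *: e j}.
    move=> /IH[eps epsP]; exists (fun j => if j == k then b else eps j) => y.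
    rewrite inE => /predU1P[->|/epsP[j jk ->]].
      by exists k; rewrite ?leqnn ?eqxx.
    by exists j; [exact: ltnW|rewrite ltn_eqF].
  rewrite mem_cat => /orP[] /mapP[t tk ->].
    by rewrite -[e k](scale1r); exact: (key false).
  by rewrite -scaleN1r; exact: (key true).
have face_diam s : onface s -> diam_le D s.
  move=> /onface_l1 sl x y /sl xl /sl yl; apply: le_trans (ler_normB _ _) _.
  by rewrite /D mulr2n mulrDl mul1r -{1}xl -yl lerD // norm_le_l1.
have good k : (k <= n.+1)%N -> {in iter M (linext (subdiv (@bary R V))) (cross e k),
    forall t, [/\ onface t, consistent (map code t) & size t = k]}.
  move=> kn t tM; suff [tf td] : onface t /\ diam_le (kap ^+ M * D) t.
    split=> //; last exact: sdn_size tM.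
    move=> c d /mapP[x xt ->] /mapP[y yt ->].
    rewrite /code !half_bit_double => lxy; congr (_ + _)%N; last by rewrite lxy.
    congr nat_of_bool; apply/eqP/negP => /negP sxy; apply: noedge.
    exists x, y; split; rewrite ?(onface_l1 _ tf) //.
    by apply: le_lt_trans Mtau; exact: td.
  have {kn} : (k <= n.+1)%N /\ t \in iter M (linext (subdiv (@bary R V))) (cross e k) by [].
  elim: M {Mtau tM} t => [|M IH] t [kn].
    move=> /(face_cross _ kn) tf; split=> //; rewrite expr0 mul1r; exact: face_diam.
  move=> /flatten_mapP[s sM ts]; have [sf sd] := IH s (conj kn sM).
  split; first exact: face_sub sf ts.
  by rewrite exprS -mulrA; apply: subdiv_diam sd ts; rewrite (sdn_size sM).
have /(_ _ _ (leqnn _)) := @alternating_parity R V e code M n.+1.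
have /[swap]/[apply] : forall k, (k <= n.+1)%N ->
    {in iter M (linext (subdiv (@bary R V))) (cross e k), forall t,
     consistent (map code t) /\ {in t, forall x, code (- x) = flip (code x)}}.
  move=> k kn t /(good _ kn)[tf tc _]; split=> // x xt.
  have [ln sn] := labN _ (onface_l1 _ tf _ xt).
  by rewrite /code /flip ln sn half_bit_double oddD odd_double addbF oddb.
apply/negP; rewrite /eval2 big_seq big1 // => t /(good _ (leqnn _))[tf tc tn].
apply/negP => alt; suff : (size (map code t) <= m)%N by rewrite size_map tn leqNgt mn.
apply: altlab_size tc _ alt => c /mapP[x xt ->].
by rewrite /code half_bit_double; exact: labm (onface_l1 _ tf _ xt).
Qed.
End Tucker.

(** * Compactness *)

Section Compactness.
Variable R : realType.

(** Asking for all smaller radii as well lets the minimum over the list serve every entry. *)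
Lemma seq_small_radius (T : eqType) (s : seq T) (P : T -> R -> Prop) :
  {in s, forall x, exists2 r, 0 < r & forall r', 0 < r' <= r -> P x r'} ->
  exists2 r, 0 < r & forall r', 0 < r' <= r -> {in s, forall x, P x r'}.
Proof.
elim: s => [|x s IH] h; first by exists 1.
have [r1 r10 h1] := h x (mem_head _ _).
have [|r2 r20 h2] := IH; first by move=> y ys; apply: h; rewrite inE ys orbT.
exists (Num.min r1 r2) => [|r']; first by rewrite lt_min r10.
rewrite le_min => /and3P[r'0 r'1 r'2] y; rewrite inE => /predU1P[->|ys].
  by apply: h1; rewrite r'0.
by apply: h2 => //; rewrite r'0.
Qed.

Lemma compact_pos (T : topologicalType) (A : set T) (phi : T -> R) :
  compact A -> continuous phi -> (forall z, A z -> 0 < phi z) ->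
  exists2 d, 0 < d & forall z, A z -> d <= phi z.
Proof.
move=> cA cphi pos; have [A0|/nonemptyPn A0] := pselect (A !=set0); last first.
  by exists 1 => // z; rewrite A0.
have [c Ac cmin] := compact_EVT_min A0 cA (continuous_subspaceT cphi).
exists (phi c) => [|z Az]; first by apply: pos; rewrite inE in Ac.
by apply: cmin; rewrite inE.
Qed.

Lemma compact_ub (T : topologicalType) (A : set T) (phi : T -> R) :
  compact A -> continuous phi ->
  exists2 M, 0 < M & forall z, A z -> phi z <= M.
Proof.
move=> cA cphi; have [A0|/nonemptyPn A0] := pselect (A !=set0); last first.
  by exists 1 => // z; rewrite A0.
have [c Ac cmax] := compact_EVT_max A0 cA (continuous_subspaceT cphi).
exists (`|phi c| + 1) => [|z Az]; first by rewrite ltr_wpDl.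
apply: (@le_trans _ _ (phi c)); first by apply: cmax; rewrite inE.
by apply: (le_trans (ler_norm _)); rewrite lerDl.
Qed.

Lemma closed_le_fun (T : topologicalType) (phi : T -> R) c :
  continuous phi -> closed [set z | phi z <= c].
Proof. by move=> /continuous_closedP/(_ _ (@closed_le R c)). Qed.

Lemma closed_ge_fun (T : topologicalType) (phi : T -> R) c :
  continuous phi -> closed [set z | c <= phi z].
Proof. by move=> /continuous_closedP/(_ _ (@closed_ge R c)). Qed.

Lemma closed_seq (T : topologicalType) (I : eqType) (s : seq I) (P : I -> set T) :
  (forall i, closed (P i)) -> closed [set z | {in s, forall i, P i z}].
Proof.
move=> cP; elim: s => [|i s IH].
  by rewrite [X in closed X](_ : _ = setT); [exact: closedT|rewrite -subTset => z _ i].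
rewrite [X in closed X](_ : _ = P i `&` [set z | {in s, forall i, P i z}]).
  exact: closedI.
rewrite predeqE => z; split=> [h|[h1 h2] j].
  by split=> [|j js]; apply: h; rewrite inE ?eqxx ?js ?orbT.
by rewrite inE => /predU1P[->//|]; exact: h2.
Qed.

(** Heine-Cantor: the distance has a positive minimum on the compact set of pairs of [A] whose
    images are at least [e] apart. *)
Lemma compact_unif (U W : normedModType R) (A : set U) (F : U -> W) (e : R) :
  compact A -> continuous F -> 0 < e ->
  exists2 t, 0 < t & forall y z, A y -> A z -> `|y - z| < t -> `|F y - F z| < e.
Proof.
move=> cA cF e0.
pose K : set (U * U) := (A `*` A) `&` [set u | e <= `|F u.1 - F u.2|].
have cK : compact K.
  apply: compact_closedI; first exact: compact_setX.
  apply: closed_ge_fun => u; apply: cvg_norm; apply: cvgB.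
    by apply: (@continuous_comp _ _ _ fst F); [exact: cvg_fst|exact: cF].
  by apply: (@continuous_comp _ _ _ snd F); [exact: cvg_snd|exact: cF].
have cd : continuous (fun u : U * U => `|u.1 - u.2|).
  by move=> u; apply: cvg_norm; apply: cvgB; [exact: cvg_fst|exact: cvg_snd].
have [|t t0 tK] := compact_pos cK cd.
  move=> [y z] [_ /= eF]; rewrite normr_gt0 subr_eq0; apply: contraTneq eF => ->.
  by rewrite subrr normr0 -ltNge.
exists t => // y z Ay Az; apply: contraTT; rewrite -!leNgt => eF.
exact: (tK (y, z)).
Qed.

Lemma continuous_normB (U : normedModType R) (x : U) :
  continuous (fun z => `|z - x|).
Proof. by move=> z; apply: cvg_norm; apply: cvgB; [exact: cvg_id|exact: cvg_cst]. Qed.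

Lemma continuous_normf (T : topologicalType) (U : normedModType R) (F : T -> U) :
  continuous F -> continuous (fun x => `|F x|).
Proof. by move=> cF x; apply: cvg_norm; exact: cF. Qed.

Lemma continuous_addf (T : topologicalType) (U : normedModType R) (a b : T -> U) :
  continuous a -> continuous b -> continuous (fun x => a x + b x).
Proof. by move=> ca cb x; apply: cvgD; [exact: ca|exact: cb]. Qed.

Lemma continuous_subf (T : topologicalType) (U : normedModType R) (a b : T -> U) :
  continuous a -> continuous b -> continuous (fun x => a x - b x).
Proof. by move=> ca cb x; apply: cvgB; [exact: ca|exact: cb]. Qed.

Lemma continuous_mulf (T : topologicalType) (a b : T -> R) :
  continuous a -> continuous b -> continuous (fun x => a x * b x).
Proof. by move=> ca cb x; apply: cvgM; [exact: ca|exact: cb]. Qed.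

Lemma continuous_scalef (T : topologicalType) c (a : T -> R) :
  continuous a -> continuous (fun x => c * a x).
Proof. by apply: continuous_mulf => x; exact: cst_continuous. Qed.

Lemma continuous_eps (U W : normedModType R) (F : U -> W) x (e : R) :
  continuous F -> 0 < e ->
  exists2 d, 0 < d & forall z, `|z - x| < d -> `|F z - F x| < e.
Proof.
move=> cF e0; have /cvgrPdist_lt/(_ e e0) : F z @[z --> x] --> F x by exact: cF.
case/nbhs_normP => d /= d0 dP; exists d => // z zx.
by rewrite distrC; apply: dP; rewrite /= distrC.
Qed.

Lemma continuous_sumf (T : topologicalType) (U : normedModType R) (I : Type)
    (s : seq I) (F : I -> T -> U) :
  (forall i, continuous (F i)) -> continuous (fun x => \sum_(i <- s) F i x).
Proof.
move=> cF; elim: s => [|i s IH].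
  by under eq_fun do rewrite big_nil; move=> x; exact: cvg_cst.
under eq_fun do rewrite big_cons.
by move=> x; apply: cvgD; [exact: cF|exact: IH].
Qed.

End Compactness.

(** * Clark's theorem *)

Section Clark.
Variables (R : realType) (n : nat).
Local Notation V := 'rV[R]_n.+1.

(** The norm of a row vector is the sup norm; this bounds it by the Euclidean one, in which the
    first-order decrease along [g] is expressed. *)
Lemma norm_sqr_le (v : V) : `|v| ^+ 2 <= \sum_i v 0 i * v 0 i.
Proof.
have [v0|v0] := eqVneq `|v| 0.
  by rewrite v0 expr0n; apply: sumr_ge0 => i _; rewrite -expr2 sqr_ge0.
have [[i j] /= E] := mx_norm_neq0 v0.
rewrite [`|v|]E ord1 (bigD1 j) //= real_normK ?num_real // expr2 lerDl.
by apply: sumr_ge0 => k _; rewrite -expr2 sqr_ge0.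
Qed.

Lemma continuous_l1norm : continuous (@l1norm R n).
Proof.
apply: continuous_sumf => i; apply: continuous_normf => y.
exact: coord_continuous.
Qed.

Variables (J : V -> R) (g : V -> V) (rho : R).
Hypotheses (rho0 : 0 < rho) (Jc : continuous J) (gc : continuous g).
Hypotheses (Jeven : forall y, J (- y) = J y) (godd : forall y, g (- y) = - g y).
Hypothesis J0 : J 0 = 0.
Hypothesis Jbd : exists B, forall y, J y <= 0 -> `|y| <= B.
(** The link between [J] and [g]: a one-sided first-order expansion, uniform on the sublevel set, so
    that a single step size serves all descents. *)
Hypothesis Jdiff : forall e, 0 < e -> exists2 eta, 0 < eta &
  forall y v, J y <= 0 -> `|v| <= eta ->
    J (y + v) <= J y + \sum_i g y 0 i * v 0 i + e * `|v|.
Hypothesis Jneg : forall y, l1norm y = rho -> J y < 0.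

Lemma bounded_compact (A : set V) (B : R) :
  closed A -> (forall y, A y -> `|y| <= B) -> compact A.
Proof.
move=> cA AB; apply: bounded_closed_compact cA; exists B; split; first exact: num_real.
by move=> b Bb y Ay; apply: le_trans (AB _ Ay) (ltW Bb).
Qed.

Lemma compact_sublevel : compact [set y | J y <= 0].
Proof.
have [B JB] := Jbd; apply: (bounded_compact (B := B)) => //.
exact: closed_le_fun.
Qed.

Lemma compact_l1sphere : compact [set y : V | l1norm y = rho].
Proof.
apply: (bounded_compact (B := rho)) => [|y <-]; last exact: norm_le_l1.
rewrite (_ : mkset _ = [set y | l1norm y <= rho] `&` [set y | rho <= l1norm y]).
  by apply: closedI; [apply: closed_le_fun|apply: closed_ge_fun];
    exact: continuous_l1norm.
rewrite predeqE => y; split=> [/= ->//|[/= h1 h2]].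
by apply/eqP; rewrite eq_le h1.
Qed.

Lemma continuous_normg : continuous (fun y => `|g y|).
Proof. exact: continuous_normf. Qed.

Section DescentMap.
Variables (h delta : R).
Definition descent (y : V) : V := y - h *: g y.

Lemma descentN y : descent (- y) = - descent y.
Proof. by rewrite /descent godd scalerN opprB opprK addrC. Qed.

Lemma iter_descentN i y : iter i descent (- y) = - iter i descent y.
Proof. by elim: i => //= i ->; exact: descentN. Qed.

Lemma continuous_iter_descent i : continuous (iter i descent).
Proof.
elim: i => [|i IH] y; first exact: cvg_id.
apply: (@continuous_comp _ _ _ (iter i descent) descent); first exact: IH.
apply: continuousB; first exact: cvg_id.
by apply: continuousZ; [exact: cst_continuous|exact: gc].
Qed.
End DescentMap.

Variable X : seq V.
Hypothesis Xcrit : {in X, forall x, g x = 0 /\ J x < 0}.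
Hypothesis Xall : forall y, g y = 0 -> J y < 0 -> y \in X \/ - y \in X.

Let Y := X ++ map -%R X.

Lemma mem_Y x : x \in Y <-> g x = 0 /\ J x < 0.
Proof.
rewrite mem_cat; split.
  case/orP => [/Xcrit//|/mapP[z /Xcrit[gz Jz] ->]].
  by rewrite godd gz oppr0 Jeven.
move=> [gx Jx]; have [->//|xX] := Xall gx Jx.
by apply/orP; right; apply/mapP; exists (- x); rewrite ?opprK.
Qed.

Lemma mem_YN x : x \in Y -> - x \in Y.
Proof. by rewrite !mem_Y godd Jeven => -[-> ?]; rewrite oppr0. Qed.

(** Points of [Y] are isolated because [Y] is finite and contains every critical point at a negative
    level. The factor 3 leaves room around the annulus between [r] and [2 r] for one descent step of
    length [r / 2]. *)
Lemma isolating_radius : exists2 r, 0 < r & {in Y, forall x z,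
  `|z - x| <= 3 * r -> J z < 0 /\ (g z = 0 -> z = x)}.
Proof.
suff [r r0 rP] : exists2 r, 0 < r & forall r', 0 < r' <= r ->
    {in Y, forall x z, `|z - x| <= 3 * r' -> J z < 0 /\ (g z = 0 -> z = x)}.
  by exists r => //; apply: rP; rewrite r0 lexx.
apply: seq_small_radius => x /[dup] xY /mem_Y[_ Jx].
have [s s0 sP] : exists2 s, 0 < s & forall s', 0 < s' <= s ->
    {in Y, forall w, `|w - x| <= 3 * s' -> w = x}.
  apply: seq_small_radius => w _; have [->|wx] := eqVneq w x; first by exists 1.
  have d0 : 0 < `|w - x| by rewrite normr_gt0 subr_eq0.
  exists (`|w - x| / 4) => [|s' /andP[s'0 s'w] wx']; first by rewrite divr_gt0.
  by exfalso; lra.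
have [|d d0 dP] := @continuous_eps _ _ _ J x (- J x) Jc; first by rewrite oppr_gt0.
exists (Num.min s (d / 4)) => [|r' /andP[r'0]]; first by rewrite lt_min s0 divr_gt0.
rewrite le_min => /andP[r's r'd] z zr.
have Jz : J z < 0.
  have /dP : `|z - x| < d by lra.
  by rewrite ltr_norml => /andP[_]; lra.
split=> // gz; apply: (sP r') => //; first by rewrite r'0.
exact/mem_Y.
Qed.

Lemma annulus_bound r : 0 < r ->
  {in Y, forall x z, `|z - x| <= 3 * r -> J z < 0 /\ (g z = 0 -> z = x)} ->
  exists2 d, 0 < d & {in Y, forall x z, r / 2 <= `|z - x| <= 3 * r -> d <= `|g z|}.
Proof.
move=> r0 rP.
suff [d d0 dP] : exists2 d, 0 < d & forall d', 0 < d' <= d ->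
    {in Y, forall x z, r / 2 <= `|z - x| <= 3 * r -> d' <= `|g z|}.
  by exists d => //; apply: dP; rewrite d0 lexx.
apply: seq_small_radius => x xY.
have cA : compact [set z | r / 2 <= `|z - x| <= 3 * r].
  rewrite (_ : mkset _ = [set z | r / 2 <= `|z - x|] `&` [set z | `|z - x| <= 3 * r]).
    apply: (bounded_compact (B := `|x| + 3 * r)).
      by apply: closedI; [apply: closed_ge_fun|apply: closed_le_fun];
        exact: continuous_normB.
    move=> z [_ /= zx]; rewrite -(subrK x z) addrC.
    by apply: le_trans (ler_normD _ _) _; rewrite lerD2l.
  by rewrite predeqE => z; split=> [/andP[]|[/= -> ->]].
have [|d d0 dP] := compact_pos cA continuous_normg.
  move=> z /andP[z1 z2]; rewrite normr_gt0; apply/eqP => gz.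
  have [_ /(_ gz) zx] := rP _ xY _ z2.
  by move: z1; rewrite zx subrr normr0; clear gz zx; lra.
by exists d => // d' /andP[_ d'd] z /dP; exact: le_trans.
Qed.

(** The part of the sublevel set at distance at least [r] from [Y] is compact and free of critical
    points, so the gradient has a positive minimum there. *)
Lemma critical_bound c r : 0 < c -> 0 < r ->
  exists2 d, 0 < d & forall z, J z <= - c -> `|g z| < d ->
    exists2 x, x \in Y & `|z - x| < r.
Proof.
move=> c0 r0; have [B JB] := Jbd.
have cA : compact ([set z | J z <= - c] `&` [set z | {in Y, forall x, r <= `|z - x|}]).
  apply: (bounded_compact (B := B)).
    apply: closedI; first exact: closed_le_fun.
    have cY (x : V) : closed [set z : V | r <= `|z - x|].
      by apply: closed_ge_fun; exact: continuous_normB.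
    exact: (closed_seq cY).
  by move=> z [/= Jz _]; apply: JB; lra.
have [|d d0 dP] := compact_pos cA continuous_normg.
  move=> z [/= Jz zY]; rewrite normr_gt0; apply/eqP => gz.
  have Jz0 : J z < 0 by clear gz; lra.
  have /zY : z \in Y by apply/mem_Y.
  by rewrite subrr normr0; clear gz; lra.
exists d => // z Jz gz; apply: contrapT => nx.
suff : d <= `|g z| by lra.
apply: dP; split=> //= x xY; rewrite leNgt; apply/negP => zx.
by apply: nx; exists x.
Qed.

Lemma oscillation_bound e : 0 < e ->
  exists2 r, 0 < r & forall r', 0 < r' <= r ->
    {in Y, forall x z, `|z - x| < 2 * r' -> `|J z - J x| < e}.
Proof.
move=> e0; apply: seq_small_radius => x xY.
have [d d0 dP] := continuous_eps x Jc e0.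
exists (d / 4) => [|r' /andP[r'0 r'd] z zr]; first by rewrite divr_gt0.
by apply: dP; lra.
Qed.

(** The drop is written as gradient times distance travelled, ready to be compared with the width of
    an annulus. The accuracy [delta / 2] in [Jdiff] costs at most half of the first-order decrease
    when the gradient is at least [delta]. *)
Lemma descent_step delta s : 0 < delta -> 0 < s -> exists2 h, 0 < h &
  forall z, J z <= 0 -> `|h *: g z| <= s /\
    (delta <= `|g z| -> J (descent h z) <= J z - `|g z| * `|h *: g z| / 2).
Proof.
move=> delta0 s0.
have [G G0 GP] := compact_ub compact_sublevel continuous_normg.
have [eta eta0 etaP] := Jdiff (divr_gt0 delta0 (ltr0n R 2)).
exists (Num.min eta s / G) => [|z Jz]; first by rewrite divr_gt0 // lt_min eta0.
set h := _ / G; have h0 : 0 < h by rewrite divr_gt0 // lt_min eta0.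
have hg : `|h *: g z| = h * `|g z| by rewrite normrZ gtr0_norm.
have : h * `|g z| <= Num.min eta s.
  by rewrite /h -mulrA ger_pMr ?lt_min ?eta0 // ler_pdivrMl // mulr1; exact: GP.
rewrite le_min -hg => /andP[he hs]; split=> // dg.
rewrite /descent; apply: le_trans (etaP z (- (h *: g z)) Jz _) _.
  by rewrite normrN.
rewrite normrN hg.
have -> : \sum_i g z 0 i * (- (h *: g z)) 0 i = - h * \sum_i g z 0 i * g z 0 i.
  by rewrite mulr_sumr; apply: eq_bigr => i _; rewrite !mxE; ring.
have := norm_sqr_le (g z); set q := \sum_i _; set u := `|g z| => uq.
have : delta * u <= u ^+ 2.
  by rewrite expr2; apply: ler_wpM2r; [exact: normr_ge0|exact: dg].
move=> du; rewrite -subr_ge0.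
have -> : J z - u * (h * u) / 2 - (J z + - h * q + delta / 2 * (h * u))
   = h * ((q - u ^+ 2) + (u ^+ 2 - delta * u) / 2) by field.
by apply: mulr_ge0; [exact: ltW|lra].
Qed.

Definition clip (r u : R) : R := Num.max r (Num.min u (2 * r)).

Lemma clip_lipschitz r a b m : `|b - a| <= m -> clip r b - clip r a <= m.
Proof.
rewrite ler_norml /clip !maxEle !minEle => /andP[h1 h2].
by case: (leP a (2 * r)) => ?; case: (leP b (2 * r)) => ?;
  case: (leP r a) => ?; case: (leP r b) => ?; case: (leP r (2 * r)) => ?; lra.
Qed.

(** Outside the enlarged annulus no gradient bound is available, but there a short step does not
    change [clip] at all. *)
Lemma clip_const r a b : 0 < r -> `|b - a| <= r / 2 -> a <= r / 2 \/ 3 * r <= a ->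
  clip r b = clip r a.
Proof.
rewrite ler_norml /clip !maxEle !minEle => r0 /andP[h1 h2] h3.
by case: (leP a (2 * r)) => ?; case: (leP b (2 * r)) => ?;
  case: (leP r a) => ?; case: (leP r b) => ?; case: (leP r (2 * r)) => ?; case: h3 => ?; lra.
Qed.

(* Crossing the annulus [r <= |z - x| <= 2 r] costs energy proportional to its
   width, which makes [J + d / 2 * clip] nonincreasing along the descent. *)
Lemma barrier r d h x z : 0 < r -> 0 < d ->
  (forall w, r / 2 <= `|w - x| <= 3 * r -> d <= `|g w|) ->
  `|h *: g z| <= r / 2 -> J (descent h z) <= J z - `|g z| * `|h *: g z| / 2 ->
  J (descent h z) + d / 2 * clip r `|descent h z - x| <=
  J z + d / 2 * clip r `|z - x|.
Proof.
move=> r0 d0 dP; have ba : `| `|descent h z - x| - `|z - x| | <= `|h *: g z|.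
  apply: le_trans (ler_dist_dist _ _) _.
  by rewrite opprB addrA subrK /descent addrAC subrr add0r normrN.
move: (dP z) ba; set a := `|z - x|; set b := `|_ - x|; set m := `|h *: _|.
set u := `|g z| => du ba ms Jd.
have m0 : 0 <= m by exact: normr_ge0.
have u0 : 0 <= u by exact: normr_ge0.
have [ra|ra] := leP (r / 2) a; last first.
  rewrite (@clip_const r a b) //; [|exact: le_trans ms|by left; exact: ltW].
  have : 0 <= u * m by exact: mulr_ge0.
  by lra.
have [ar|ar] := leP a (3 * r); last first.
  rewrite (@clip_const r a b) //; [|exact: le_trans ms|by right; exact: ltW].
  have : 0 <= u * m by exact: mulr_ge0.
  by lra.
have cl := @clip_lipschitz r _ _ _ ba.
have {}du : d <= u by apply: du; rewrite ra ar.
have : d * (clip r b - clip r a) <= d * m by rewrite ler_pM2l.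
have : d * m <= u * m by exact: ler_wpM2r.
by lra.
Qed.

(** As long as the gradient is at least [delta], each step costs at least [k] of energy, and the
    energy is bounded below on the compact sublevel set. This bounds the number of steps
    independently of the start. *)
Lemma first_time h delta c : 0 < h -> 0 < delta -> 0 < c ->
  (forall z, J z <= 0 -> delta <= `|g z| ->
     J (descent h z) <= J z - `|g z| * `|h *: g z| / 2) ->
  exists m : nat, forall y, J y <= - c ->
    exists i : nat, [/\ (i <= m)%N, `|g (iter i (descent h) y)| < delta,
      forall j, (j < i)%N -> delta <= `|g (iter j (descent h) y)| &
      forall j, (j <= i)%N -> J (iter j (descent h) y) <= - c].
Proof.
move=> h0 delta0 c0 step.
have [L L0 LP] : exists2 L, 0 < L & forall z, J z <= 0 -> - J z <= L.
  apply: compact_ub compact_sublevel _ => z; apply: continuousN; exact: Jc.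
pose k := delta * (h * delta) / 2.
have k0 : 0 < k by rewrite divr_gt0 // !mulr_gt0.
pose m := (Num.truncn (L / k)).+1.
have mk : L < m%:R * k by rewrite -ltr_pdivrMr // /m truncnS_gt.
exists m => y Jy.
have desc j : (forall i, (i < j)%N -> delta <= `|g (iter i (descent h) y)|) ->
    J (iter j (descent h) y) <= - c - j%:R * k.
  elim: j => [|j IH] hj; first by rewrite mul0r subr0.
  have {}IH : J (iter j (descent h) y) <= - c - j%:R * k.
    by apply: IH => i ij; apply: hj; exact: ltnW.
  have jk : 0 <= j%:R * k by apply: mulr_ge0; rewrite ?ler0n // ltW.
  have gj := hj j (leqnn _).
  have Jj0 : J (iter j (descent h) y) <= 0 by lra.
  have := step _ Jj0 gj.
  rewrite iterS normrZ (gtr0_norm h0).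
  move: gj; set u := `|g _| => gj Js.
  have uu : delta * (h * delta) <= u * (h * u).
    apply: ler_pM => //; rewrite ?ler_pM2l //; try exact: ltW.
    by apply: mulr_ge0; exact: ltW.
  have -> : (j.+1)%:R * k = j%:R * k + k by rewrite -natr1 mulrDl mul1r.
  by rewrite /k in IH *; lra.
have ex : exists i, (`|g (iter i (descent h) y)| < delta) && (i <= m)%N.
  apply: contrapT => nex.
  have big i : (i <= m)%N -> delta <= `|g (iter i (descent h) y)|.
    by move=> im; rewrite leNgt; apply/negP => gi; apply: nex; exists i; rewrite gi.
  have Jm : J (iter m (descent h) y) <= - c - m%:R * k.
    by apply: desc => i im; apply: big; exact: ltnW.
  have Jm0 : J (iter m (descent h) y) <= 0.
    have : 0 <= m%:R * k by apply: mulr_ge0; rewrite ?ler0n // ltW.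
    by lra.
  by have := LP _ Jm0; lra.
case: (ex_minnP ex) => i /andP[gi im] imin.
have before j : (j < i)%N -> delta <= `|g (iter j (descent h) y)|.
  move=> ji; rewrite leNgt; apply/negP => gj.
  by have := imin j; rewrite gj (leq_trans (ltnW ji)) // leqNgt ji => /(_ isT).
exists i; split=> // j ji.
have jk : 0 <= j%:R * k by apply: mulr_ge0; rewrite ?ler0n // ltW.
have : J (iter j (descent h) y) <= - c - j%:R * k.
  by apply: desc => l lj; apply: before; exact: leq_trans ji.
by lra.
Qed.

(** Through [Xcrit] and [Xall], [X] represents all critical points at negative levels up to sign, so
    this bounds the number of pairs below by the dimension [n.+1]. *)
Theorem clark : (n < size X)%N.
Proof.
rewrite ltnNge; apply/negP => sX.
have [r r0 rP] := isolating_radius.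
have [d d0 dP] := annulus_bound r0 rP.
have [c c0 cP] : exists2 c, 0 < c & forall y, l1norm y = rho -> c <= - J y.
  apply: compact_pos compact_l1sphere _ _ => [z|z /Jneg]; last by rewrite oppr_gt0.
  by apply: continuousN; exact: Jc.
(* Energy budget: the crossing costs [d * r / 2], while the two endpoints have energies within
   [d * r / 8] of the common value at [x] and [- x]. *)
have dr0 : 0 < d * r / 8 by rewrite divr_gt0 // mulr_gt0.
have [b0 b00 bP] := oscillation_bound dr0.
pose b := Num.min b0 (r / 4).
have b_gt0 : 0 < b by rewrite lt_min b00 divr_gt0.
have br : b <= r / 4 by rewrite ge_min lexx orbT.
have {}bP : {in Y, forall x z, `|z - x| < 2 * b -> `|J z - J x| < d * r / 8}.
  by apply: bP; rewrite b_gt0 ge_min lexx.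
have [delta delta0 deltaP] := critical_bound c0 b_gt0.
have [h h0 hP] := descent_step delta0 (divr_gt0 r0 (ltr0n R 2)).
have hs z (Jz : J z <= 0) : `|h *: g z| <= r / 2 by have [] := hP z Jz.
have step z (Jz : J z <= 0) : delta <= `|g z| ->
    J (descent h z) <= J z - `|g z| * `|h *: g z| / 2 by have [] := hP z Jz.
have [m mP] := first_time h0 delta0 c0 step.
pose D i := iter i (descent h).
(* Defined by a bounded search, the stopping time is a total function and depends only on norms of
   gradients, so it is the same for [y] and [- y]. *)
pose stop y := find (fun i => `|g (D i y)| < delta) (iota 0 m.+1).
have stopP y : l1norm y = rho -> [/\ (stop y <= m)%N, `|g (D (stop y) y)| < delta,
      forall j, (j < stop y)%N -> delta <= `|g (D j y)| &
      forall j, (j <= stop y)%N -> J (D j y) <= - c].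
  move=> /cP cy; have [|i [im gi before Ji]] := mP y; first by lra.
  suff -> : stop y = i by [].
  have hi : has (fun i => `|g (D i y)| < delta) (iota 0 m.+1).
    by apply/hasP; exists i; rewrite // mem_iota /= add0n ltnS.
  have sm : (stop y < m.+1)%N by rewrite -(size_iota 0 m.+1) -has_find.
  apply/eqP; rewrite eqn_leq; apply/andP; split; rewrite leqNgt; apply/negP => lt.
    have := before_find 0%N lt; rewrite nth_iota ?add0n ?gi //.
  have := nth_find 0%N hi; rewrite -/(stop y) nth_iota // add0n.
  by rewrite ltNge before.
pose Z y := D (stop y) y.
have stopN y : stop (- y) = stop y.
  by apply: eq_find => i; rewrite /D iter_descentN godd normrN.
have ZN y : Z (- y) = - Z y by rewrite /Z stopN /D iter_descentN.
have [tau tau0 tauP] : exists2 tau, 0 < tau & forall i, (i <= m)%N -> forall y z,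
    l1norm y = rho -> l1norm z = rho -> `|y - z| < tau -> `|D i y - D i z| < b.
  have [tau tau0 tauP] : exists2 tau, 0 < tau & forall tau', 0 < tau' <= tau ->
      {in iota 0 m.+1, forall i y z, l1norm y = rho -> l1norm z = rho ->
         `|y - z| < tau' -> `|D i y - D i z| < b}.
    apply: seq_small_radius => i _.
    have [tau tau0 tauP] := compact_unif compact_l1sphere
      (@continuous_iter_descent h i) b_gt0.
    exists tau => // tau' /andP[_ t't] y z yS zS yz; apply: tauP => //.
    exact: lt_le_trans yz t't.
  exists tau => // i im; apply: tauP; rewrite ?tau0 ?lexx //.
  by rewrite mem_iota /= add0n ltnS.
(* Within distance [3 * r] of [x] the critical point [- x] would equal [x], so [x] would be 0,
   against [J x < 0 = J 0]. *)
have oppfar x : x \in Y -> 3 * r < `|- x - x|.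
  move=> xY; rewrite ltNge; apply/negP => /(rP _ xY)[_].
  have /mem_Y[gx Jx] := mem_YN xY => /(_ gx) xNx.
  have : (2 : R) *: x = 0 by rewrite scaler_nat mulr2n -{1}xNx addNr.
  move/eqP; rewrite scaler_eq0 pnatr_eq0 /= => /eqP x0.
  by move: Jx; rewrite xNx x0 J0 ltxx.
have excl w x : x \in Y -> `|w - x| < b -> `|w + x| < b -> False.
  move=> /oppfar xx w1 w2.
  have : `|- x - x| <= `|w - x| + `|w + x|.
    have -> : - x - x = (w - x) - (w + x) by rewrite opprD addrACA subrr add0r.
    exact: ler_normB.
  by lra.
(* At time [stop y] the orbit of [z] is within [2 * b] of [x], hence inside the annulus around [x];
   at its own stopping time it is near [- x], hence outside. *)
have noflip y z x : l1norm y = rho -> l1norm z = rho -> `|y - z| < tau ->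
    (stop y <= stop z)%N -> x \in Y -> `|Z y - x| < b -> `|Z z + x| < b -> False.
  move=> yS zS yz lyz xY Zy Zz; have [sm _ before Jle] := stopP _ zS.
  pose Psi w := J w + d / 2 * clip r `|w - x|.
  have mono k : (stop y + k <= stop z)%N -> Psi (D (stop y + k)%N z) <= Psi (D (stop y) z).
    elim: k => [|k IH]; first by rewrite addn0.
    rewrite addnS => lt; apply: le_trans (IH (ltnW lt)).
    have Jk : J (D (stop y + k)%N z) <= 0 by have := Jle _ (ltnW lt); lra.
    apply: barrier => //; [exact: dP|exact: hs|].
    by apply: step => //; exact: before.
  have := mono (stop z - stop y)%N; rewrite subnKC // => /(_ (leqnn _)).
  have near_x : `|D (stop y) z - x| < 2 * b.
    rewrite -(subrK (D (stop y) y) (D (stop y) z)) -addrA.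
    apply: (le_lt_trans (ler_normD _ _)).
    rewrite distrC; have := tauP _ (leq_trans lyz sm) _ _ yS zS yz.
    by rewrite -/(Z y); lra.
  have /ltW := bP _ xY _ near_x.
  have : `|Z z - - x| < 2 * b by rewrite opprK; lra.
  move=> /(bP _ (mem_YN xY))/ltW; rewrite Jeven -/(Z z) /Psi.
  rewrite !ler_norml => /andP[h1 h2] /andP[h3 h4].
  have far : 2 * r <= `|Z z - x|.
    have xx := oppfar _ xY.
    have : `|- x - x| <= `|- x - Z z| + `|Z z - x|.
      by rewrite -{1}(subrK (Z z) (- x)) -addrA; exact: ler_normD.
    have -> : `|- x - Z z| = `|Z z + x| by rewrite -opprD normrN addrC.
    by lra.
  have -> : clip r `|Z z - x| = 2 * r.
    by rewrite /clip min_r // max_r //; lra.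
  have -> : clip r `|D (stop y) z - x| = r.
    by rewrite /clip max_l // ge_min; apply/orP; left; lra.
  by rewrite -/(Z z); nra.
pose close (z x : V) := (`|z - x| < b) || (`|z + x| < b).
have closeN z : close (- z) =1 close z.
  by move=> x; rewrite /close -opprD normrN -(normrN (- z + x)) opprD opprK orbC.
(* The label is the index of the pair approached by the descent, the sign tells which member; [excl]
   makes the sign unambiguous. *)
pose lab y := find (close (Z y)) X.
pose sg y := `|Z y - nth 0 X (lab y)| < b.
have hasX y : l1norm y = rho -> has (close (Z y)) X.
  move=> yS; have [_ gy _ Jy] := stopP _ yS.
  have [x xY Zx] := deltaP _ (Jy _ (leqnn _)) gy.
  move: xY; rewrite mem_cat => /orP[xX|/mapP[w wX xw]]; apply/hasP.
    by exists x; rewrite // /close Zx.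
  by exists w; rewrite // /close -{2}(opprK w) -xw Zx orbT.
have nthX y : l1norm y = rho -> close (Z y) (nth 0 X (lab y)).
  by move=> /hasX; exact: nth_find.
have labX y : l1norm y = rho -> (lab y < size X)%N by rewrite -has_find; exact: hasX.
have inY j : (j < size X)%N -> nth 0 X j \in Y.
  by move=> jX; rewrite mem_cat mem_nth.
have labN y : lab (- y) = lab y by rewrite /lab ZN; apply: eq_find; exact: closeN.
have sgN y : l1norm y = rho -> sg (- y) = ~~ sg y.
  move=> yS; have := nthX _ yS; rewrite /sg labN ZN /close.
  set x := nth _ _ _; rewrite -opprD normrN => cl.
  have xY : x \in Y by apply: inY; exact: labX.
  apply/idP/idP => [Zx|/negbTE Zx]; last by move: cl; rewrite Zx.
  by apply/negP => Zx'; exact: excl xY Zx' Zx.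
have [y [z [yS zS yz lyz sgyz]]] := tucker rho0 tau0 sX (fun y yS => labX y yS)
  (fun y yS => conj (labN y) (sgN y yS)).
have := nthX _ yS; have := nthX _ zS; move: sgyz; rewrite /sg lyz /close.
have := inY _ (labX _ zS); set x := nth _ _ _ => xY sgyz cz cy.
(* The representative is replaced by its negative if necessary, so that the end for [y] is near [x']
   and that for [z] near [- x']. *)
have [x' [x'Y Zy Zz]] : exists x', [/\ x' \in Y, `|Z y - x'| < b & `|Z z + x'| < b].
  move: sgyz cz cy; case: (boolP (`|Z y - x| < b)) => Zy;
    case: (boolP (`|Z z - x| < b)) => Zz //= _.
    by move=> Zz' _; exists x.
  by move=> _ Zy'; exists (- x); split; rewrite ?opprK ?mem_YN.
have [le|/ltnW le] := leqP (stop y) (stop z); first exact: noflip yz le x'Y Zy Zz.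
apply: (noflip z y (- x')) => //; rewrite ?opprK ?mem_YN //.
by rewrite distrC.
Qed.

End Clark.

(** * Primitives of odd functions *)

Section OneVariable.
Variable R : realType.
Implicit Types (f F : R -> R) (a b t : R).

Lemma MVT_is_derive f F a b : (forall x : R, is_derive x 1 F (f x)) -> a <= b ->
  exists2 c, a <= c <= b & F b - F a = f c * (b - a).
Proof.
move=> dF ab; have [|c cab E] := MVT_segment ab (fun x _ => dF x); last first.
  by exists c => //; rewrite in_itv in cab.
by apply: derivable_within_continuous => x _; exact: ex_derive.
Qed.

Lemma increment_bound f F a t : (forall x : R, is_derive x 1 F (f x)) ->
  exists2 c, `|c - a| <= `|t| & F (a + t) - F a = f c * t.
Proof.
move=> dF; have [t0|t0] := leP 0 t.
  have [|c /andP[c1 c2] E] := @MVT_is_derive f F a (a + t) dF; first by rewrite lerDl.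
  exists c; last by rewrite E addrC addKr.
  by rewrite !ger0_norm ?subr_ge0 //; lra.
have [|c /andP[c1 c2] E] := @MVT_is_derive f F (a + t) a dF; first by rewrite gerDl ltW.
exists c; last by rewrite -[LHS]opprB E; ring.
by rewrite !ler0_norm ?subr_le0 ?(ltW t0) //; lra.
Qed.

Lemma continuous_primitive f F : (forall x : R, is_derive x 1 F (f x)) -> continuous F.
Proof.
move=> dF x; apply: differentiable_continuous; apply/derivable1_diffP.
exact: ex_derive.
Qed.

(* [P] integrates [f] cut off to the positive half-line, so [P x + P (- x)] is an
   even primitive of the odd function [f]. *)
Lemma even_primitive f : continuous f -> (forall s, f (- s) = - f s) ->
  exists F, [/\ forall x : R, is_derive x 1 F (f x), F 0 = 0 & forall x, F (- x) = F x].
Proof.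
move=> cf fodd; have f0 : f 0 = 0.
  by have := fodd 0; rewrite oppr0 => h; lra.
pose fp t := f ((t + `|t|) / 2).
have cfp : continuous fp.
  move=> t; apply: (@continuous_comp _ _ _ (fun t => (t + `|t|) / 2) f); last exact: cf.
  apply: cvgM; last exact: cvg_cst.
  by apply: cvgD; [exact: cvg_id|apply: cvg_norm; exact: cvg_id].
have fpN t : t <= 0 -> fp t = 0.
  by move=> t0; rewrite /fp ler0_norm // subrr mul0r.
have fpP t : 0 <= t -> fp t = f t.
  by move=> t0; rewrite /fp ger0_norm //; congr f; field.
(* The integrand vanishes on the negative half-line, so starting at -1 changes nothing and makes 0
   an interior point for the fundamental theorem of calculus. Left of it, [P] is locally zero. *)
pose P x := \int[lebesgue_measure]_(t in `[(-1), x]) fp t.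
have PN x : x <= 0 -> P x = 0.
  move=> x0; rewrite /P (@eq_Rintegral _ _ _ _ _ (cst 0)).
    by rewrite /Rintegral integral0.
  move=> t; rewrite inE /= in_itv /= => /andP[_ tx]; apply: fpN.
  exact: le_trans x0.
have dP (x : R) : is_derive x 1 P (fp x).
  have [x1|x1] := leP x (-1 / 2).
    rewrite fpN; last by lra.
    apply: (@near_eq_is_derive _ _ _ (cst 0 : R -> R)).
    have x0 : x < 0 by lra.
    near=> y; rewrite PN //; apply/ltW; near: y; exact: lt_nbhsl.
  have x1u : x < x + 1 by lra.
  have fi : lebesgue_measure.-integrable `[(-1), x + 1] (EFin \o fp).
    apply: continuous_compact_integrable; first exact: segment_compact.
    exact: continuous_subspaceT.
  have ax : -1 < x by lra.
  have [dPx Px] := continuous_FTC1_closed x1u fi ax (cfp x).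
  by apply: (DeriveDef dPx); rewrite -derive1E Px.
exists (fun x => P x + P (- x)); split.
- move=> x; have -> : f x = fp x + - fp (- x).
    have [x0|x0] := leP 0 x; first by rewrite fpP // [X in _ - X]fpN ?subr0 //; lra.
    by rewrite fpN ?(ltW x0) // fpP ?fodd ?add0r ?opprK //; lra.
  apply: is_deriveD.
  rewrite -mulrN1; apply: (@is_derive1_comp _ P -%R).
- by rewrite oppr0 PN ?addr0.
- by move=> x; rewrite opprK addrC.
Unshelve. all: by end_near. Qed.

Lemma is_derive_sub_quadratic f F a (s : R) : (forall x : R, is_derive x 1 F (f x)) ->
  is_derive s 1 (fun s => F s - a / 2 * s ^+ 2) (f s - a * s).
Proof.
move=> dF; have -> : f s - a * s =
    f s - (cst (a / 2) s *: ((2%:R * id s ^+ 1) *: (1 : R)) + (id ^+ 2) s *: (0 : R)).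
  by rewrite /cst /= /GRing.scale /= !mulr0 expr1; field.
apply: (@is_deriveB _ _ _ F (cst (a / 2) * (id : R -> R) ^+ 2)).
Qed.

(** Beyond some [M] the function F - a s^2 / 2 has positive derivative, on the segment up to [M] it
    is bounded by compactness, and evenness covers negative [s]. *)
Lemma primitive_lower_bound f F a :
  (forall x : R, is_derive x 1 F (f x)) -> (forall x, F (- x) = F x) ->
  (\forall s \near +oo, a < f s / s) ->
  exists C, forall s, a / 2 * s ^+ 2 - C <= F s.
Proof.
move=> dF Feven [M0 [_ M0P]].
pose M := Num.max M0 0 + 1.
have M_gt : M0 < M by rewrite /M ltr_pwDr // le_max lexx.
have M_gt0 : 0 < M by rewrite /M ltr_pwDr // le_max lexx orbT.
pose G s := F s - a / 2 * s ^+ 2.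
have dG (s : R) : is_derive s 1 G (f s - a * s) := is_derive_sub_quadratic a s dF.
have cG : continuous G by exact: (continuous_primitive dG).
have [C C0 CP] : exists2 C, 0 < C & forall s, `[0, M]%classic s -> - G s <= C.
  apply: (@compact_ub _ _ _ (fun s => - G s)); first exact: segment_compact.
  by move=> s; apply: continuousN; exact: cG.
exists C; have pos s : 0 <= s -> - C <= G s.
  move=> s0; have [sM|Ms] := leP s M.
    by rewrite lerNl; apply: CP; rewrite /= in_itv /= s0.
  have [c /andP[Mc cs] E] := MVT_is_derive dG (ltW Ms).
  have GM : - G M <= C by apply: CP; rewrite /= in_itv /= lexx andbT ltW.
  have c0 : 0 < c by exact: lt_le_trans Mc.
  have ac : a * c < f c by rewrite -ltr_pdivlMr //; apply: M0P; exact: lt_le_trans Mc.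
  have : 0 <= (f c - a * c) * (s - M) by apply: mulr_ge0; lra.
  by rewrite -E; lra.
move=> s; suff : - C <= G s by rewrite /G; lra.
have [s0|s0] := leP 0 s; first exact: pos.
by have : G (- s) = G s; [rewrite /G Feven sqrrN|move=> <-; apply: pos; lra].
Qed.

Lemma primitive_upper_bound f F b :
  (forall x : R, is_derive x 1 F (f x)) -> f 0 = 0 -> F 0 = 0 ->
  (forall x, F (- x) = F x) -> (\forall s \near 0^'+, f s / s < b) ->
  exists2 r, 0 < r & forall s, `|s| <= r -> F s <= b / 2 * s ^+ 2.
Proof.
move=> dF f0 F0 Feven [r0 /= r0_gt r0P].
pose G s := F s - b / 2 * s ^+ 2.
have dG (s : R) : is_derive s 1 G (f s - b * s) := is_derive_sub_quadratic b s dF.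
exists (r0 / 2) => [|s sr]; first by rewrite divr_gt0.
suff pos t : 0 <= t -> t <= r0 / 2 -> G t <= 0.
  suff : G s <= 0 by rewrite /G; lra.
  have [s0|s0] := leP 0 s; first by apply: pos => //; apply: le_trans sr; exact: ler_norm.
  have <- : G (- s) = G s by rewrite /G Feven sqrrN.
  apply: pos; first by lra.
  by apply: le_trans sr; rewrite -normrN ler_norm.
move=> t0 tr.
have sneg c : 0 < c -> c <= r0 / 2 -> f c - b * c <= 0.
  move=> c0 cr; rewrite subr_le0 -ler_pdivrMr //; apply/ltW; apply: r0P => //=.
  by rewrite sub0r normrN gtr0_norm //; lra.
have [c /andP[c0 ct] E] := MVT_is_derive dG t0.
move: E; rewrite {2}/G F0 expr0n mulr0 !subr0 => ->.
(* The mean value point may be 0, where the quotient says nothing; there [f 0 = 0] is used. *)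
apply: mulr_le0_ge0 => //; have [c0'|c0'] := leP c 0.
  have -> : c = 0 by apply/eqP; rewrite eq_le c0'.
  by rewrite f0 mulr0 subr0.
by apply: sneg => //; exact: le_trans tr.
Qed.
End OneVariable.

(** * Rayleigh quotients *)

Section Rayleigh.
Variable R : realType.

Definition normsq n (y : 'rV[R]_n) : R := \sum_i y 0 i ^+ 2.

Lemma normsq_ge0 n (y : 'rV[R]_n) : 0 <= normsq y.
Proof. by apply: sumr_ge0 => i _; exact: sqr_ge0. Qed.

Lemma normsq_eq0 n (y : 'rV[R]_n) : normsq y = 0 -> y = 0.
Proof.
move/eqP; rewrite psumr_eq0; last by move=> i _; exact: sqr_ge0.
move=> /allP h; apply/rowP => i; rewrite mxE.
by have := h i (mem_index_enum _); rewrite sqrf_eq0 => /eqP.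
Qed.

Lemma normsq0 n : @normsq n 0 = 0.
Proof. by rewrite /normsq big1 // => i _; rewrite mxE expr0n. Qed.

Lemma normsqE n (y : 'rV[R]_n) : (y *m y^T) 0 0 = normsq y.
Proof. by rewrite mxE; apply: eq_bigr => i _; rewrite mxE expr2. Qed.

Lemma normsqZ n (a : R) (y : 'rV[R]_n) : normsq (a *: y) = a ^+ 2 * normsq y.
Proof. by rewrite /normsq mulr_sumr; apply: eq_bigr => i _; rewrite mxE exprMn. Qed.

Lemma continuous_normsq_mulmx n m (B : 'M[R]_(n, m)) :
  continuous (fun y : 'rV[R]_n => normsq (y *m B)).
Proof.
apply: continuous_sumf => i y.
have c : continuous (fun y : 'rV[R]_n => (y *m B) 0 i).
  under eq_fun do rewrite mxE.
  apply: continuous_sumf => j z.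
  by apply: continuousM; [exact: coord_continuous|exact: cst_continuous].
exact: (continuousM (c y) (c y)).
Qed.

Lemma quadratic_ge0_lin (b c : R) : (forall t, 0 <= t * b *+ 2 + t ^+ 2 * c) -> b = 0.
Proof.
move=> h; have c0 : 0 <= c by have := h 1; have := h (-1); lra.
apply/eqP; rewrite -sqrf_eq0 eq_le sqr_ge0 andbT.
have c1 : c + 1 != 0 by apply: lt0r_neq0; lra.
(* The minimiser [- b / c] with [c + 1] in place of [c], which avoids the degenerate case
   [c = 0]. *)
have := h (- b / (c + 1)).
have -> : - b / (c + 1) * b *+ 2 + (- b / (c + 1)) ^+ 2 * c =
          - (b ^+ 2 * ((c + 2) / (c + 1) ^+ 2)) by field.
rewrite oppr_ge0 pmulr_lle0 // divr_gt0 ?exprn_gt0 //; lra.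
Qed.

(** [lambda_min] is an infimum of eigenvalues. The minimum [mu] of the quadratic form on the
    Euclidean unit sphere is attained at some [u], and [u] turns out to be an eigenvector for [mu];
    so the infimum is at most [mu]. *)
Lemma lambda_min_le n m (M : 'M[R]_(m, n)) (y : 'rV[R]_n) :
  lambda_min (M^T *m M) * normsq y <= normsq (y *m M^T).
Proof.
have [->|y0] := eqVneq y 0; first by rewrite mul0mx !normsq0 mulr0.
have n0 z : z != 0 -> 0 < @normsq n z.
  move=> z0; rewrite lt_neqAle normsq_ge0 andbT eq_sym.
  by apply: contra_neq z0; exact: normsq_eq0.
have gramE z : (z *m (M^T *m M) *m z^T) 0 0 = normsq (z *m M^T).
  by rewrite -normsqE trmx_mul trmxK !mulmxA.
pose S : set 'rV[R]_n := [set z | normsq z = 1].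
have c1 : continuous (@normsq n).
  by move: (@continuous_normsq_mulmx n n 1%:M); under eq_fun do rewrite mulmx1.
have cS : compact S.
  apply: bounded_closed_compact.
    exists 1; split; first exact: num_real.
    move=> b b1 z /= zS; apply: le_trans (ltW b1).
    rewrite [leLHS]/Num.norm /= mx_normrE; apply: bigmax_le => // -[i j] _ /=.
    rewrite ord1 -(@ler_pXn2r _ 2) ?nnegrE // expr1n real_normK ?num_real //.
    rewrite -zS /normsq (bigD1 j) //= lerDl.
    by apply: sumr_ge0 => k _; exact: sqr_ge0.
  rewrite (_ : S = [set z | normsq z <= 1] `&` [set z | 1 <= normsq z]).
    by apply: closedI; [exact: closed_le_fun|exact: closed_ge_fun].
  rewrite predeqE => z; split=> [/= ->//|[/= h1 h2]].
  by apply/eqP; rewrite eq_le h1.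
have nS z : z != 0 -> S ((Num.sqrt (normsq z))^-1 *: z).
  by move=> /n0 z0; rewrite /S /= normsqZ exprVn sqr_sqrtr ?normsq_ge0 // mulVf // gt_eqF.
have [u uS umin] := compact_EVT_min (ex_intro _ _ (nS y y0)) cS
  (continuous_subspaceT (@continuous_normsq_mulmx n m M^T)).
set mu := normsq (u *m M^T) in umin.
rewrite inE /S /= in uS.
have mu_le z : mu * normsq z <= normsq (z *m M^T).
  have [->|z0] := eqVneq z 0; first by rewrite mul0mx !normsq0 mulr0.
  have := umin _ (mem_set (nS z z0)); rewrite -scalemxAl normsqZ exprVn.
  by rewrite sqr_sqrtr ?normsq_ge0 // ler_pdivlMl ?n0 // mulrC.
have u0 : u != 0.
  apply/eqP => u0; move: uS; rewrite u0 /normsq big1.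
    by move/eqP; rewrite eq_sym oner_eq0.
  by move=> i _; rewrite mxE expr0n.
apply: le_trans (mu_le y); apply: ler_wpM2r; first exact: normsq_ge0.
(* The infimum is meaningful only for a set bounded below: eigenvalues of a Gram matrix are
   nonnegative. *)
apply: ge_inf.
  exists 0 => a /= /eigenvalueP[v vA v0].
  have : (v *m (M^T *m M) *m v^T) 0 0 = a * normsq v.
    by rewrite vA -scalemxAl mxE normsqE.
  rewrite gramE => E.
  by rewrite -(pmulr_lge0 _ (n0 v v0)) -E normsq_ge0.
apply/eigenvalueP; exists u => //.
pose C := M^T *m M - mu%:M.
have CT : C^T = C by rewrite /C linearB /= trmx_mul trmxK tr_scalar_mx.
pose b (y z : 'rV[R]_n) := (y *m C *m z^T) 0 0.
have bE z : b z z = normsq (z *m M^T) - mu * normsq z.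
  rewrite /b /C mulmxBr mulmxBl [LHS]mxE; congr (_ + _).
    exact: gramE.
  by rewrite mxE mul_mx_scalar -scalemxAl mxE normsqE.
have bsym y1 z1 : b y1 z1 = b z1 y1.
  rewrite /b -[in LHS](trmxK (y1 *m C *m z1^T)) mxE !trmx_mul trmxK CT.
  by rewrite mulmxA.
have CE : C = M^T *m M - mu%:M by [].
(* First variation at the minimiser: [b] is positive semidefinite and vanishes at [u], so its linear
   term in the direction [u *m C] is zero. That term is the squared norm of [u *m C]. *)
clearbody C; have : b u (u *m C) = 0.
  apply: (@quadratic_ge0_lin _ (b (u *m C) (u *m C))) => t.
  have : 0 <= b (u + t *: (u *m C)) (u + t *: (u *m C)).
    by rewrite bE subr_ge0.
  have -> : b (u + t *: (u *m C)) (u + t *: (u *m C)) =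
     b u u + t * b u (u *m C) + t * b (u *m C) u + t ^+ 2 * b (u *m C) (u *m C).
    have trD : (u + t *: (u *m C))^T = u^T + t *: (u *m C)^T.
      by apply/matrixP => i j; rewrite !mxE.
    have aE (A B : 'M[R]_1) : (A + B) 0 0 = A 0 0 + B 0 0 by rewrite mxE.
    have zE k (A : 'M[R]_1) : (k *: A) 0 0 = k * A 0 0 by rewrite mxE.
    rewrite /b trD !mulmxDl !mulmxDr -!scalemxAl -!scalemxAr !aE !zE.
    by ring.
  rewrite [b u u]bE uS mulr1 subrr add0r (bsym (u *m C) u) => h.
  by rewrite mulr2n; exact: h.
rewrite /b normsqE => /normsq_eq0; rewrite CE mulmxBr mul_mx_scalar => /eqP.
by rewrite subr_eq0 => /eqP.
Qed.
End Rayleigh.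

(** * The quadratic part of the energy *)

Section Energy.
Variables (R : realType) (N : nat) (p q : int -> R).
Implicit Types (y z : 'rV[R]_N) (k : int).

Definition ext y : int -> R := extE y^T.

Lemma extE_out y k : (k <= 0) || (N%:Z < k) -> ext y k = 0.
Proof.
by move=> kN; apply: big1 => j _; case: eqP kN => // ->; have := ltn_ord j; lia.
Qed.

Lemma extE_in y (j : 'I_N) : ext y (j.+1)%:Z = y 0 j.
Proof.
rewrite /ext /extE (bigD1 j) //= eqxx mxE big1 ?addr0 // => i ij.
by case: eqP => // -[] /ord_inj ji; rewrite ji eqxx in ij.
Qed.

Lemma extD y z k : ext (y + z) k = ext y k + ext z k.
Proof.
rewrite /ext /extE -big_split; apply: eq_bigr => j _ /=.
by case: ifP => _; rewrite ?addr0 // !mxE.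
Qed.

Lemma ext_basis y k : ext y k = \sum_j y 0 j * extE (delta_mx j 0 : 'cV[R]_N) k.
Proof.
apply: eq_bigr => j _; rewrite /extE (bigD1 j) //= big1 ?addr0; last first.
  by move=> i /negbTE ij; rewrite mxE ij; case: ifP.
by rewrite !mxE !eqxx; case: ifP => _; rewrite ?mulr1 ?mulr0.
Qed.

Definition D1 y (i : nat) : R := Delta (ext y) i%:Z.
(** The shift makes natural indices start at 0, and lets [D2 y i] and [D1 y i] go with the weights
    [p] and [q] at [i.+1], as in the equation. *)
Definition D2 y (i : nat) : R := Delta2 (ext y) (i%:Z - 1).

Lemma D1E y i : D1 y i = ext y i.+1%:Z - ext y i%:Z.
Proof. by rewrite /D1 /Delta; congr (ext y _ - _); lia. Qed.

Lemma D2E y i : D2 y i = ext y i.+1%:Z - 2 * ext y i%:Z + ext y (i%:Z - 1).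
Proof.
rewrite /D2 /Delta2 /Delta subrK.
have -> : i%:Z + 1 = i.+1%:Z by lia.
by ring.
Qed.

Lemma D1D y z i : D1 (y + z) i = D1 y i + D1 z i.
Proof. by rewrite !D1E !extD; ring. Qed.

Lemma D2D y z i : D2 (y + z) i = D2 y i + D2 z i.
Proof. by rewrite !D2E !extD; ring. Qed.

Lemma VmxE y (i : 'I_N.+1) : (y *m (Vmx R N)^T) 0 i = D1 y i.
Proof.
rewrite mxE D1E !ext_basis -sumrB; apply: eq_bigr => j _.
by rewrite !mxE /Delta -mulrBr; congr (_ * (extE _ _ - _)); lia.
Qed.

Lemma WmxE y (i : 'I_N.+2) : (y *m (Wmx R N)^T) 0 i = D2 y i.
Proof.
rewrite mxE D2E !ext_basis mulr_sumr -sumrB -big_split; apply: eq_bigr => j _ /=.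
rewrite !mxE /Delta2 /Delta subrK.
have -> : i%:Z + 1 = i.+1%:Z by lia.
by ring.
Qed.

Section Shift.
Variables (F : nat -> R -> R) (y : 'rV[R]_N).
Hypothesis F0 : forall i, F i 0 = 0.

(** With its two companions this is the whole of summation by parts: the boundary values are 0, so
    shifted sums reduce to the [N] interior coordinates. [F] depends on the index in order to carry
    weights. *)
Lemma shift0 m : (N <= m)%N ->
  \sum_(i < m) F i (ext y i.+1%:Z) = \sum_(k < N) F k (y 0 k).
Proof.
move=> Nm; rewrite -(big_mkord xpredT (fun i => F i (ext y i.+1%:Z))).
rewrite (big_cat_nat (leq0n N) Nm) /= [X in _ + X]big_nat_cond [X in _ + X]big1.
  by rewrite addr0 big_mkord; apply: eq_bigr => k _; rewrite extE_in.
by move=> i /andP[/andP[Ni _] _]; rewrite extE_out ?F0.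
Qed.
End Shift.

Lemma shift1 (F : nat -> R -> R) y m : (forall i, F i 0 = 0) -> (N <= m)%N ->
  \sum_(i < m.+1) F i (ext y i%:Z) = \sum_(k < N) F k.+1 (y 0 k).
Proof.
move=> F0 Nm; rewrite -(big_mkord xpredT (fun i => F i (ext y i%:Z))).
rewrite big_nat_recl // extE_out // F0 add0r big_mkord.
exact: (@shift0 (fun i => F i.+1)).
Qed.

Lemma shift2 (F : nat -> R -> R) y m : (forall i, F i 0 = 0) -> (N <= m)%N ->
  \sum_(i < m.+2) F i (ext y (i%:Z - 1)) = \sum_(k < N) F k.+2 (y 0 k).
Proof.
move=> F0 Nm; rewrite -(big_mkord xpredT (fun i => F i (ext y (i%:Z - 1)))).
rewrite big_nat_recl // extE_out // F0 add0r big_mkord.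
rewrite -(@shift1 (fun i => F i.+1) _ m) //; apply: eq_bigr => i _.
by congr (F _ (ext y _)); lia.
Qed.

(** From (a - b)^2 <= 2 (a^2 + b^2), where every coordinate occurs twice. *)
Lemma sum_D1_le y : \sum_(i < N.+1) D1 y i ^+ 2 <= 4 * normsq y.
Proof.
have s1 := @shift0 (fun _ s => s ^+ 2) y (fun=> expr0n _ 2) N.+1 (leqnSn N).
have s2 := @shift1 (fun _ s => s ^+ 2) y N (fun=> expr0n _ 2) (leqnn N).
have -> : 4 * normsq y = \sum_(i < N.+1) 2 * (ext y i.+1%:Z ^+ 2 + ext y i%:Z ^+ 2).
  by rewrite -mulr_sumr big_split /= s1 s2 /normsq; ring.
apply: ler_sum => i _; rewrite D1E.
by have := sqr_ge0 (ext y i.+1%:Z + ext y i%:Z); rewrite !expr2; lra.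
Qed.

(** Cauchy-Schwarz with weights 1, 2, 1: (a - 2b + c)^2 <= 4 (a^2 + 2b^2 + c^2), and every
    coordinate has total weight 4. The defect is 2(a + b)^2 + 2(b + c)^2 + (a - c)^2. *)
Lemma sum_D2_le y : \sum_(i < N.+2) D2 y i ^+ 2 <= 16 * normsq y.
Proof.
have s1 := @shift0 (fun _ s => s ^+ 2) y (fun=> expr0n _ 2) N.+2
  (leq_trans (leqnSn N) (leqnSn _)).
have s2 := @shift1 (fun _ s => s ^+ 2) y N.+1 (fun=> expr0n _ 2) (leqnSn N).
have s3 := @shift2 (fun _ s => s ^+ 2) y N (fun=> expr0n _ 2) (leqnn N).
have -> : 16 * normsq y = \sum_(i < N.+2) 4 * (ext y i.+1%:Z ^+ 2
    + 2 * ext y i%:Z ^+ 2 + ext y (i%:Z - 1) ^+ 2).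
  by rewrite -mulr_sumr !big_split /= -mulr_sumr s1 s2 s3 /normsq; ring.
apply: ler_sum => i _; rewrite D2E.
set a := ext y i.+1%:Z; set b := ext y i%:Z; set c := ext y _.
have := sqr_ge0 (a + b); have := sqr_ge0 (b + c); have := sqr_ge0 (a - c).
by rewrite !expr2; lra.
Qed.

Lemma sum_D1_ge y : lambda1 R N * normsq y <= \sum_(i < N.+1) D1 y i ^+ 2.
Proof.
apply: le_trans (lambda_min_le (Vmx R N) y) _.
by rewrite le_eqVlt; apply/orP; left; apply/eqP/eq_bigr => i _; rewrite VmxE.
Qed.

Lemma sum_D2_ge y : lambda2 R N * normsq y <= \sum_(i < N.+2) D2 y i ^+ 2.
Proof.
apply: le_trans (lambda_min_le (Wmx R N) y) _.
by rewrite le_eqVlt; apply/orP; left; apply/eqP/eq_bigr => i _; rewrite WmxE.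
Qed.

Definition form y z : R := \sum_(i < N.+2) p i.+1%:Z * D2 y i * D2 z i
                         - \sum_(i < N.+1) q i.+1%:Z * D1 y i * D1 z i.

Lemma formC y z : form y z = form z y.
Proof. by congr (_ - _); apply: eq_bigr => i _; rewrite mulrAC. Qed.

Lemma formDr y z1 z2 : form y (z1 + z2) = form y z1 + form y z2.
Proof.
rewrite /form.
under eq_bigr do rewrite D2D mulrDr.
under [X in _ - X]eq_bigr do rewrite D1D mulrDr.
by rewrite !big_split /=; ring.
Qed.

Lemma form_square y z : form (y + z) (y + z) = form y y + 2 * form y z + form z z.
Proof. by rewrite formDr !(formC (y + z)) !formDr (formC z y); ring. Qed.

Definition linpart y (k : nat) : R :=
  Delta2 (fun j => p j * Delta2 (ext y) (j - 2)) k.+1%:Z +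
  Delta (fun j => q j * Delta (ext y) (j - 1)) k.+1%:Z.

Lemma linpartE y (k : nat) : linpart y k =
  p k.+1%:Z * D2 y k - 2 * (p k.+2%:Z * D2 y k.+1) + p k.+3%:Z * D2 y k.+2
  - (q k.+1%:Z * D1 y k - q k.+2%:Z * D1 y k.+1).
Proof.
rewrite /linpart {1}/Delta2 {1 2 3}/Delta.
have e1 : k.+1%:Z + 1 = k.+2%:Z by lia.
have e2 : k.+2%:Z + 1 = k.+3%:Z by lia.
rewrite !e1 !e2.
have -> : k.+3%:Z - 2 = k.+2%:Z - 1 by lia.
have -> : k.+2%:Z - 2 = k.+1%:Z - 1 by lia.
have -> : k.+1%:Z - 2 = k%:Z - 1 by lia.
rewrite -!/(D2 _ _).
have -> : k.+2%:Z - 1 = k.+1%:Z by lia.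
have -> : k.+1%:Z - 1 = k%:Z by lia.
by rewrite -!/(D1 _ _); ring.
Qed.

(** Summation by parts: the difference operator of the equation represents the form, so half of
    [form y y] has gradient [linpart y]. *)
Lemma form_gradient y z : form y z = \sum_(k < N) linpart y k * z 0 k.
Proof.
pose phi i := p i.+1%:Z * D2 y i; pose psi i := q i.+1%:Z * D1 y i.
have s1 := @shift0 (fun i s => phi i * s) z (fun=> mulr0 _) N.+2
  (leq_trans (leqnSn N) (leqnSn _)).
have s2 := @shift1 (fun i s => phi i * s) z N.+1 (fun=> mulr0 _) (leqnSn N).
have s3 := @shift2 (fun i s => phi i * s) z N (fun=> mulr0 _) (leqnn N).
have t1 := @shift0 (fun i s => psi i * s) z (fun=> mulr0 _) N.+1 (leqnSn N).
have t2 := @shift1 (fun i s => psi i * s) z N (fun=> mulr0 _) (leqnn N).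
transitivity ((\sum_(i < N.+2) phi i * ext z i.+1%:Z
   - 2 * \sum_(i < N.+2) phi i * ext z i%:Z
   + \sum_(i < N.+2) phi i * ext z (i%:Z - 1))
   - (\sum_(i < N.+1) psi i * ext z i.+1%:Z - \sum_(i < N.+1) psi i * ext z i%:Z)).
  rewrite mulr_sumr -!sumrB -big_split /=; congr (_ - _); apply: eq_bigr => i _.
    by rewrite (D2E z) -/(phi i); ring.
  by rewrite (D1E z) -/(psi i); ring.
rewrite s1 s2 s3 t1 t2 mulr_sumr -!sumrB -big_split -sumrB /=.
by apply: eq_bigr => k _; rewrite linpartE /phi /psi; ring.
Qed.

Lemma pmin_le (i : 'I_N.+2) : pmin N p <= p i.+1%:Z.
Proof. exact: (bigmin_le _ i (fun i : 'I_N.+2 => p i.+1%:Z)). Qed.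
Lemma pmax_ge (i : 'I_N.+2) : p i.+1%:Z <= pmax N p.
Proof. exact: (le_bigmax _ (fun i : 'I_N.+2 => p i.+1%:Z)). Qed.
Lemma qmin_le (i : 'I_N.+1) : qmin N q <= q i.+1%:Z.
Proof. exact: (bigmin_le _ i (fun i : 'I_N.+1 => q i.+1%:Z)). Qed.
Lemma qmax_ge (i : 'I_N.+1) : q i.+1%:Z <= qmax N q.
Proof. exact: (le_bigmax _ (fun i : 'I_N.+1 => q i.+1%:Z)). Qed.

Lemma weighted_sum_le m (w : 'I_m -> R) (u : 'I_m -> R) c : (forall i, w i <= c) ->
  \sum_i w i * u i * u i <= c * \sum_i u i ^+ 2.
Proof.
move=> wc; rewrite mulr_sumr; apply: ler_sum => i _.
by rewrite -mulrA -expr2 ler_wpM2r ?sqr_ge0.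
Qed.

Lemma weighted_sum_ge m (w : 'I_m -> R) (u : 'I_m -> R) c : (forall i, c <= w i) ->
  c * \sum_i u i ^+ 2 <= \sum_i w i * u i * u i.
Proof.
move=> wc; rewrite mulr_sumr; apply: ler_sum => i _.
by rewrite -mulrA -expr2 ler_wpM2r ?sqr_ge0.
Qed.

Hypothesis pmin_ge0 : 0 <= pmin N p.

(** The case distinction in [eta] picks the valid bound for the [q] sum: a negative [qmax] calls for
    a lower bound on the sum of squares, a nonnegative one for an upper bound. [form_upper] is the
    mirror image with [xi]. *)
Lemma form_lower y : - alpha1 N p q * normsq y <= form y y.
Proof.
have hp := weighted_sum_ge (D2 y) (fun i => pmin_le i).
have hq := weighted_sum_le (D1 y) (fun i => qmax_ge i).
have hp2 : pmin N p * (lambda2 R N * normsq y) <= pmin N p * \sum_(i < N.+2) D2 y i ^+ 2.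
  by apply: ler_wpM2l => //; exact: sum_D2_ge.
have hq2 : qmax N q * \sum_(i < N.+1) D1 y i ^+ 2 <= Defs.eta N q * qmax N q * normsq y.
  rewrite /Defs.eta; case: (ltP (qmax N q) 0) => q0.
    by rewrite [_ * qmax N q]mulrC -mulrA ler_wnM2l ?(ltW q0) // sum_D1_ge.
  by rewrite [_ * qmax N q]mulrC -mulrA ler_wpM2l // sum_D1_le.
rewrite /alpha1 /eta' pmin_ge0 /form.
by move: hp hq hp2 hq2; lra.
Qed.

Lemma form_upper y : form y y <= - alpha2 N p q * normsq y.
Proof.
have hp := weighted_sum_le (D2 y) (fun i => pmax_ge i).
have hq := weighted_sum_ge (D1 y) (fun i => qmin_le i).
have pmax_ge0 : 0 <= pmax N p.
  exact: le_trans pmin_ge0 (le_trans (pmin_le ord0) (pmax_ge ord0)).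
have hp2 : pmax N p * \sum_(i < N.+2) D2 y i ^+ 2 <= pmax N p * (16 * normsq y).
  by apply: ler_wpM2l => //; exact: sum_D2_le.
have hq2 : xi N q * qmin N q * normsq y <= qmin N q * \sum_(i < N.+1) D1 y i ^+ 2.
  rewrite /xi; case: (leP 0 (qmin N q)) => q0.
    by rewrite [_ * qmin N q]mulrC -mulrA ler_wpM2l // sum_D1_ge.
  by rewrite [_ * qmin N q]mulrC -mulrA ler_wnM2l ?(ltW q0) // sum_D1_le.
rewrite /alpha2 /form.
by move: hp hq hp2 hq2; lra.
Qed.
End Energy.

(** * The energy functional *)

Section Rows.
Variable R : realType.

Lemma norm_coord_le n (y : 'rV[R]_n) i : `|y 0 i| <= `|y|.
Proof.
rewrite [leRHS]/Num.norm /= mx_normrE.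
exact: (le_bigmax _ (fun ij : 'I_1 * 'I_n => `|y ij.1 ij.2|) (0, i)).
Qed.

Lemma norm_row_lt n (y : 'rV[R]_n) e : 0 < e -> (forall i, `|y 0 i| < e) -> `|y| < e.
Proof.
move=> e0 ye; rewrite [ltLHS]/Num.norm /= mx_normrE.
by apply: bigmax_lt => // -[i j] _ /=; rewrite ord1.
Qed.

Lemma normsq_le n (y : 'rV[R]_n) : normsq y <= n%:R * `|y| ^+ 2.
Proof.
rewrite mulr_natl -[X in _ *+ X]card_ord -sumr_const; apply: ler_sum => i _.
by rewrite -real_normK ?num_real // ler_sqr ?nnegrE // norm_coord_le.
Qed.

Lemma continuous_row (U : normedModType R) n (g : U -> 'rV[R]_n) :
  (forall i, continuous (fun y => g y 0 i)) -> continuous g.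
Proof.
move=> gi y; apply/cvgrPdist_lt => e e0.
have [r r0 rP] : exists2 r, 0 < r & forall r', 0 < r' <= r -> {in enum 'I_n, forall i z,
    `|z - y| < r' -> `|g z 0 i - g y 0 i| < e}.
  apply: seq_small_radius => i _; have [d d0 dP] := @continuous_eps _ _ _ _ y e (gi i) e0.
  by exists d => // r' /andP[_ rd] z zr; apply: dP; exact: lt_le_trans rd.
apply/nbhs_normP; exists r => //= z yz; apply: norm_row_lt => // i.
rewrite !mxE distrC; apply: (rP r) => //; first by rewrite r0 lexx.
  by rewrite mem_enum.
by rewrite distrC.
Qed.
End Rows.

Section Functional.
Variables (R : realType) (n : nat) (p q : int -> R) (f : int -> R -> R).
Local Notation N := n.+1.
Local Notation V := 'rV[R]_N.
Hypothesis pmin_ge0 : 0 <= pmin N p.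
Hypothesis fcont : forall k : 'I_N, continuous (f k.+1%:Z).
Hypothesis fodd : forall (k : 'I_N) s, f k.+1%:Z (- s) = - f k.+1%:Z s.

Definition gradient (y : V) : V := \row_k (linpart p q y k + f k.+1%:Z (y 0 k)).

Lemma continuous_ext k : continuous (fun y : V => ext y k).
Proof.
under eq_fun do rewrite ext_basis.
apply: continuous_sumf => j; apply: continuous_mulf => y; last exact: cst_continuous.
exact: coord_continuous.
Qed.

Lemma continuous_D1 i : continuous (fun y : V => D1 y i).
Proof. by under eq_fun do rewrite D1E; apply: continuous_subf; exact: continuous_ext. Qed.

Lemma continuous_D2 i : continuous (fun y : V => D2 y i).
Proof.
under eq_fun do rewrite D2E; apply: continuous_addf; last exact: continuous_ext.
apply: continuous_subf; first exact: continuous_ext.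
by apply: continuous_scalef; exact: continuous_ext.
Qed.

Lemma continuous_linpart i : continuous (fun y : V => linpart p q y i).
Proof.
under eq_fun do rewrite linpartE.
apply: continuous_subf; last first.
  by apply: continuous_subf; apply: continuous_scalef; exact: continuous_D1.
apply: continuous_addf; last by apply: continuous_scalef; exact: continuous_D2.
apply: continuous_subf; first by apply: continuous_scalef; exact: continuous_D2.
by do 2 apply: continuous_scalef; exact: continuous_D2.
Qed.

Lemma continuous_gradient : continuous gradient.
Proof.
apply: continuous_row => i; under eq_fun do rewrite mxE.
apply: continuous_addf; first exact: continuous_linpart.
move=> y; apply: (@continuous_comp _ _ _ (fun y : V => y 0 i) (f i.+1%:Z)).
  exact: coord_continuous.
exact: fcont.
Qed.

Lemma ext_opp (y : V) k : ext (- y) k = - ext y k.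
Proof.
by rewrite !ext_basis -sumrN; apply: eq_bigr => j _; rewrite mxE mulNr.
Qed.

Lemma linpart_opp (y : V) i : linpart p q (- y) i = - linpart p q y i.
Proof. by rewrite !linpartE !D1E !D2E !ext_opp; ring. Qed.

Lemma form_opp (y : V) : form p q (- y) (- y) = form p q y y.
Proof.
rewrite !form_gradient; apply: eq_bigr => k _.
by rewrite linpart_opp mxE mulrNN.
Qed.

Lemma gradient_opp y : gradient (- y) = - gradient y.
Proof.
by apply/rowP => k; rewrite /gradient !mxE linpart_opp fodd [RHS]opprD.
Qed.

Variable F : 'I_N -> R -> R.
Hypothesis dF : forall k (s : R), is_derive s 1 (F k) (f k.+1%:Z s).
Hypothesis F0 : forall k, F k 0 = 0.
Hypothesis Feven : forall k s, F k (- s) = F k s.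

Definition energy (y : V) : R := form p q y y / 2 + \sum_k F k (y 0 k).

Lemma continuous_energy : continuous energy.
Proof.
apply: continuous_addf.
  under eq_fun do rewrite form_gradient mulrC.
  apply: continuous_scalef; apply: continuous_sumf => k.
  apply: continuous_mulf; first exact: continuous_linpart.
  by move=> y; exact: coord_continuous.
apply: continuous_sumf => k y.
apply: (@continuous_comp _ _ _ (fun y : V => y 0 k) (F k)).
  exact: coord_continuous.
exact: (continuous_primitive (dF k)).
Qed.

Lemma energy_opp y : energy (- y) = energy y.
Proof.
rewrite /energy form_opp; congr (_ + _); apply: eq_bigr => k _.
by rewrite mxE Feven.
Qed.

Lemma energy0 : energy 0 = 0.
Proof.
rewrite /energy form_gradient !big1 ?mul0r ?addr0 // => k _.
  by rewrite mxE F0.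
by rewrite mxE mulr0.
Qed.

Section Coercive.
Hypothesis growth : forall k : 'I_N,
  exists a C, alpha1 N p q < a /\ forall s, a / 2 * s ^+ 2 - C <= F k s.

Lemma energy_bounded : exists B, forall y, energy y <= 0 -> `|y| <= B.
Proof.
have [a aP] := choice growth; have {aP} [C aC] := choice aP.
pose c := \sum_k `|C k|.
(* The added 1 turns u^2 <= M - 1 into u <= M by 2u <= u^2 + 1, without a square root. *)
pose M k := c / ((a k - alpha1 N p q) / 2) + 1.
have d0 k : 0 < (a k - alpha1 N p q) / 2 by have [h _] := aC k; lra.
have c0 : 0 <= c by exact: sumr_ge0.
have M0 k : 0 <= M k by apply: addr_ge0 => //; apply: divr_ge0 => //; exact: ltW.
exists (\sum_k M k + 1) => y Jy; apply/ltW/norm_row_lt.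
  by apply: ltr_wpDl => //; exact: sumr_ge0.
move=> k; apply: (@le_lt_trans _ _ (\sum_k M k)); last by rewrite ltrDl.
apply: (@le_trans _ _ (M k)); last by rewrite (bigD1 k) //= lerDl sumr_ge0.
have sumle : \sum_k (a k - alpha1 N p q) / 2 * y 0 k ^+ 2 <= c.
  have lo := form_lower q pmin_ge0 y.
  have : \sum_k (a k / 2 * y 0 k ^+ 2 - `|C k|) <= \sum_k F k (y 0 k).
    apply: ler_sum => i _; have [_ /(_ (y 0 i)) h] := aC i.
    by have := ler_norm (C i); lra.
  have -> : \sum_k (a k - alpha1 N p q) / 2 * y 0 k ^+ 2 =
      \sum_k (a k / 2 * y 0 k ^+ 2 - `|C k|) + c - alpha1 N p q / 2 * normsq y.
    rewrite /normsq mulr_sumr -big_split -sumrB /=.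
    by apply: eq_bigr => i _; field.
  by move: Jy; rewrite /energy; lra.
have yk : (a k - alpha1 N p q) / 2 * y 0 k ^+ 2 <= c.
  apply: le_trans sumle; rewrite (bigD1 k) //= lerDl; apply: sumr_ge0 => i _.
  by apply: mulr_ge0; [exact: ltW|exact: sqr_ge0].
have {}yk : y 0 k ^+ 2 <= M k - 1 by rewrite /M addrK ler_pdivlMr // mulrC.
rewrite -real_normK ?num_real // in yk.
have := normr_ge0 (y 0 k); move: yk; set u := `|_| => yk u0.
by have := sqr_ge0 (u - 1); rewrite sqrrB1 => h; lra.
Qed.

Lemma energy_taylor e : 0 < e -> exists2 eta, 0 < eta &
  forall y v, energy y <= 0 -> `|v| <= eta ->
    energy (y + v) <= energy y + \sum_k gradient y 0 k * v 0 k + e * `|v|.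
Proof.
move=> e0; have [B BP] := energy_bounded.
(* Half of [e] is shared among the [N] nonlinear terms, the other half absorbs the quadratic
   remainder [form v v / 2]. *)
pose e1 := e / (2 * N%:R).
have N0 : 0 < N%:R :> R by rewrite ltr0n.
have e10 : 0 < e1 by rewrite divr_gt0 // mulr_gt0.
have [t t0 tP] : exists2 t, 0 < t & forall t', 0 < t' <= t ->
    {in enum 'I_N, forall (k : 'I_N) (s s' : R),
    `|s| <= B -> `|s'| <= B + 1 -> `|s' - s| < t' -> `|f k.+1%:Z s' - f k.+1%:Z s| < e1}.
  apply: seq_small_radius => k _.
  (* The radius [B + 1] also contains the displaced coordinates, as steps are at most 1. *)
  have [t t0 tP] := compact_unif (@segment_compact _ (- (B + 1)) (B + 1)) (@fcont k) e10.
  exists t => // t' /andP[_ t't] s s' sB s'B ss'.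
  apply: tP; rewrite /= ?in_itv /= -?ler_norml //; last exact: lt_le_trans t't.
  by apply: le_trans sB _; rewrite lerDl.
pose K := `|alpha2 N p q| * N%:R + 1.
have K0 : 0 < K by rewrite ltr_wpDl // mulr_ge0.
exists (Num.min (Num.min (t / 2) 1) (e / K)) => [|y v Jy].
  by rewrite !lt_min ltr01 !divr_gt0.
rewrite !le_min => /andP[/andP[vt v1] vK].
have yB (k : 'I_N) : `|y 0 k| <= B by apply: le_trans (norm_coord_le _ _) (BP _ Jy).
have Fk (k : 'I_N) : F k (y 0 k + v 0 k) <=
    F k (y 0 k) + f k.+1%:Z (y 0 k) * v 0 k + e1 * `|v|.
  have [c cy E] := increment_bound (y 0 k) (v 0 k) (dF k).
  have vk := norm_coord_le v k.
  have : `|f k.+1%:Z c - f k.+1%:Z (y 0 k)| < e1.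
    apply: (tP t) => //; rewrite ?t0 ?lexx ?mem_enum //; last by lra.
    rewrite -(subrK (y 0 k) c); apply: le_trans (ler_normD _ _) _.
    by have := yB k; lra.
  move=> /ltW fc; have : (f k.+1%:Z c - f k.+1%:Z (y 0 k)) * v 0 k <= e1 * `|v|.
    by apply: le_trans (ler_norm _) _; rewrite normrM; exact: ler_pM.
  by move: E; lra.
have sumF : \sum_k F k (y 0 k + v 0 k) <=
    \sum_k F k (y 0 k) + \sum_(k < N) f k.+1%:Z (y 0 k) * v 0 k + e / 2 * `|v|.
  apply: le_trans (ler_sum _ (fun k _ => Fk k)) _; rewrite !big_split /= lerD2l.
  have Ne : e1 * `|v| *+ N = e / 2 * `|v|.
    by rewrite -[LHS]mulr_natl /e1; field; rewrite gt_eqF.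
  by rewrite sumr_const card_ord Ne.
have formv : form p q v v / 2 <= e / 2 * `|v|.
  have up := form_upper q pmin_ge0 v; have nv := normsq_le v.
  have h1 : - alpha2 N p q * normsq v <= `|alpha2 N p q| * (N%:R * `|v| ^+ 2).
    apply: (@le_trans _ _ (`|alpha2 N p q| * normsq v)).
      by rewrite ler_wpM2r ?normsq_ge0 // -normrN ler_norm.
    by rewrite ler_wpM2l.
  have h2 : K * `|v| <= e by rewrite mulrC -ler_pdivlMr.
  have h3 : K * `|v| * `|v| <= e * `|v| by rewrite ler_wpM2r.
  have h4 : 0 <= `|v| * `|v| by rewrite mulr_ge0.
  by move: h1 h3; rewrite /K expr2; lra.
have -> : \sum_k gradient y 0 k * v 0 k =
    form p q y v + \sum_(k < N) f k.+1%:Z (y 0 k) * v 0 k.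
  rewrite form_gradient -big_split /=; apply: eq_bigr => k _.
  by rewrite mxE mulrDl.
rewrite /energy form_square.
under eq_bigr do rewrite mxE.
by move: sumF formv; lra.
Qed.
End Coercive.

(** On a small sphere the energy is at most half the sum of (b_k - alpha2) y_k^2, and some
    coordinate is nonzero. The sup norm is at most the l1-norm, so the local bounds on [F] apply to
    every coordinate. *)
Lemma energy_small_sphere :
  (forall k : 'I_N, exists2 b, b < alpha2 N p q &
     exists2 r, 0 < r & forall s, `|s| <= r -> F k s <= b / 2 * s ^+ 2) ->
  exists2 rho, 0 < rho & forall y, l1norm y = rho -> energy y < 0.
Proof.
move=> small.
have {}small (k : 'I_N) : exists b, b < alpha2 N p q /\
    exists2 r, 0 < r & forall s, `|s| <= r -> F k s <= b / 2 * s ^+ 2.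
  by have [b ? ?] := small k; exists b.
have [b bP] := choice small.
have [rho rho0 rhoP] : exists2 r, 0 < r & forall r', 0 < r' <= r -> {in enum 'I_N,
    forall k s, `|s| <= r' -> F k s <= b k / 2 * s ^+ 2}.
  apply: seq_small_radius => k _; have [_ [r r0 rP]] := bP k.
  by exists r => // r' /andP[_ r'r] s sr; apply: rP; exact: le_trans r'r.
exists rho => // y yrho.
have [k yk] : exists k, y 0 k != 0.
  apply: contrapT => h; move: rho0; rewrite -yrho /l1norm big1 ?ltxx // => k _.
  by apply/eqP; rewrite normr_eq0; apply/negP => /negP yk; apply: h; exists k.
have FkP i : F i (y 0 i) <= b i / 2 * y 0 i ^+ 2.
  apply: (rhoP rho); rewrite ?rho0 ?lexx ?mem_enum //.
  by rewrite -yrho; apply: le_trans (norm_coord_le _ _) (norm_le_l1 _).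
have up := form_upper q pmin_ge0 y.
have sF : \sum_k F k (y 0 k) <= \sum_k b k / 2 * y 0 k ^+ 2 by exact: ler_sum.
have : 0 < \sum_k (alpha2 N p q - b k) / 2 * y 0 k ^+ 2.
  rewrite (bigD1 k) //= ltr_pwDl //.
    have [bk _] := bP k; apply: mulr_gt0; first by lra.
    by rewrite lt_neqAle sqr_ge0 andbT eq_sym sqrf_eq0.
  apply: sumr_ge0 => i _; have [bi _] := bP i.
  by apply: mulr_ge0; [lra|exact: sqr_ge0].
have -> : \sum_k (alpha2 N p q - b k) / 2 * y 0 k ^+ 2 =
    alpha2 N p q / 2 * normsq y - \sum_k b k / 2 * y 0 k ^+ 2.
  by rewrite /normsq mulr_sumr -sumrB; apply: eq_bigr => i _; field.
by rewrite /energy; lra.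
Qed.

Lemma critical_solution y : gradient y = 0 -> is_solution N p q f (ext y).
Proof.
move=> gy; split; last first.
  by split; [|split; [|split]]; apply: extE_out; lia.
move=> k k1N; have kN : (`|k|%N.-1 < N)%N by lia.
have -> : k = (Ordinal kN).+1%:Z by rewrite /=; lia.
have /rowP/(_ (Ordinal kN)) := gy; rewrite !mxE => <-.
by rewrite /bvp_lhs extE_in.
Qed.
End Functional.

(** * From Clark's bound to a list of distinct pairs *)

Section Counting.
Variables (R : realType) (n : nat).
Local Notation V := 'rV[R]_n.+1.

Lemma uniq_signed_cons (X : seq V) (y : V) : y != 0 -> y \notin X -> - y \notin X ->
  uniq (X ++ map -%R X) -> uniq ((y :: X) ++ map -%R (y :: X)).
Proof.
move=> y0 yX yNX uX; rewrite /= -cat1s uniq_catCA /= mem_cat inE !negb_or uX andbT.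
rewrite mem_cat negb_or yX yNX /=.
have mN z : (z \in map -%R X) = (- z \in X).
  by rewrite -{1}(opprK z) (mem_map (@oppr_inj _)).
rewrite !mN opprK yX yNX !andbT.
apply: contra_neq y0 => yy; have : (2 : R) *: y = 0 by rewrite scaler_nat mulr2n {1}yy addNr.
by move/eqP; rewrite scaler_eq0 pnatr_eq0 /= => /eqP.
Qed.

Lemma multiplicity (J : V -> R) (g : V -> V) (rho : R) :
  0 < rho -> continuous J -> continuous g ->
  (forall y, J (- y) = J y) -> (forall y, g (- y) = - g y) -> J 0 = 0 ->
  (exists B, forall y, J y <= 0 -> `|y| <= B) ->
  (forall e, 0 < e -> exists2 eta, 0 < eta &
     forall y v, J y <= 0 -> `|v| <= eta ->
       J (y + v) <= J y + \sum_i g y 0 i * v 0 i + e * `|v|) ->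
  (forall y, l1norm y = rho -> J y < 0) ->
  exists X : seq V, [/\ size X = n.+1, uniq (X ++ map -%R X) &
    {in X ++ map -%R X, forall y, g y = 0}].
Proof.
move=> rho0 Jc gc Jeven godd J0 Jbd Jdiff Jneg.
(* Pairs are collected one at a time: if [m <= n] pairs could not be extended, they would be all the
   pairs at negative levels, against [clark]. *)
suff key m : (m <= n.+1)%N -> exists X : seq V, [/\ size X = m,
    uniq (X ++ map -%R X) & {in X, forall y, g y = 0 /\ J y < 0}].
  have [X [sX uX Xc]] := key _ (leqnn n.+1); exists X; split=> // y.
  rewrite mem_cat => /orP[/Xc[]//|/mapP[z /Xc[gz _] ->]].
  by rewrite godd gz oppr0.
elim: m => [_|m IH mn]; first by exists [::].
have [X [sX uX Xc]] := IH (ltnW mn).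
have [y [gy Jy yX yNX]] : exists y, [/\ g y = 0, J y < 0, y \notin X & - y \notin X].
  apply: contrapT => nex.
  have Xall y : g y = 0 -> J y < 0 -> y \in X \/ - y \in X.
    move=> gy Jy; apply/orP; apply: contrapT => /negP; rewrite negb_or => /andP[yX yNX].
    by apply: nex; exists y.
  have := clark rho0 Jc gc Jeven godd J0 Jbd Jdiff Jneg Xc Xall.
  by rewrite sX ltnNge -ltnS mn.
exists (y :: X); split.
- by rewrite /= sX.
- by apply: uniq_signed_cons => //; apply: contraTneq Jy => ->; rewrite J0 ltxx.
- by move=> z; rewrite inE => /predU1P[->//|]; exact: Xc.
Qed.
End Counting.

Theorem theorem6 (R : realType) (N : nat) (f : int -> R -> R) (p q : int -> R) :
  (0 < N)%N ->
  (forall k : int, 1 <= k <= N%:Z -> continuous (f k)) ->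
  (forall k : int, 1 <= k <= N%:Z -> forall s : R, f k (- s) = - f k s) ->
  0 <= pmin N p ->
  (forall k : int, 1 <= k <= N%:Z ->
     (exists l : R, (f k s / s) @[s --> +oo] --> l /\ alpha1 N p q < l)
     \/ (f k s / s) @[s --> +oo] --> +oo) ->
  (forall k : int, 1 <= k <= N%:Z ->
     exists l : R, (f k s / s) @[s --> 0^'+] --> l /\ l < alpha2 N p q) ->
  exists ys : 'I_(2 * N) -> (int -> R),
    (forall i, is_solution N p q f (ys i)) /\
    (forall i j, i != j ->
       exists k : int, -1 <= k <= N%:Z + 2 /\ ys i k != ys j k).
Proof.
case: N => // n _ fcont fodd pmin0 finf fzero.
have ord_range (k : 'I_n.+1) : 1 <= k.+1%:Z <= n.+1%:Z by have := ltn_ord k; lia.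
have fc (k : 'I_n.+1) := fcont _ (ord_range k).
have fo (k : 'I_n.+1) := fodd _ (ord_range k).
have [F FP] := choice (fun k : 'I_n.+1 => even_primitive (fc k) (fo k)).
have dF k : forall s : R, is_derive s 1 (F k) (f k.+1%:Z s) by have [] := FP k.
have F0 k : F k 0 = 0 by have [] := FP k.
have Feven k : forall s, F k (- s) = F k s by have [] := FP k.
have growth (k : 'I_n.+1) : exists a C, alpha1 n.+1 p q < a /\
    forall s, a / 2 * s ^+ 2 - C <= F k s.
  (* The strict gap between [alpha1] and the limit leaves room for [a]: the midpoint, or
     [alpha1 + 1] when the limit is infinite. *)
  have [a [al ah]] : exists a, alpha1 n.+1 p q < a /\
      \forall s \near +oo, a < f k.+1%:Z s / s.
    have [[l [fl al]]|fy] := finf _ (ord_range k).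
      exists ((alpha1 n.+1 p q + l) / 2); split; first by lra.
      by apply: (cvgr_gt _ fl); lra.
    exists (alpha1 n.+1 p q + 1); split; first by lra.
    exact: cvgry_gt.
  by have [C CP] := primitive_lower_bound (dF k) (Feven k) ah; exists a, C.
have small (k : 'I_n.+1) : exists2 b, b < alpha2 n.+1 p q &
    exists2 r, 0 < r & forall s, `|s| <= r -> F k s <= b / 2 * s ^+ 2.
  have [l [fl al]] := fzero _ (ord_range k).
  exists ((l + alpha2 n.+1 p q) / 2); first by lra.
  apply: (primitive_upper_bound (dF k)) => //.
    by have := fo k 0; rewrite oppr0; lra.
  by apply: (cvgr_lt _ fl); lra.
have [rho rho0 rhoP] := energy_small_sphere pmin0 small.
have [X [sX uX Xc]] := multiplicity rho0 (continuous_energy dF)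
  (continuous_gradient fc) (energy_opp p q Feven) (gradient_opp p q fo)
  (energy0 p q F0) (energy_bounded pmin0 growth) (energy_taylor pmin0 fc dF growth)
  rhoP.
pose Y := X ++ map -%R X.
have sY : size Y = (2 * n.+1)%N by rewrite size_cat size_map sX mul2n addnn.
exists (fun i : 'I_(2 * n.+1) => ext (nth 0 Y i)); split=> [i|i j ij].
  have gi : gradient p q f (nth 0 Y i) = 0 by apply: (Xc); rewrite mem_nth // sY.
  exact: critical_solution gi.
have /eqP/rowP yij : nth 0 Y i != nth 0 Y j by rewrite nth_uniq ?sY.
have [k ykk] : exists k, nth 0 Y i 0 k != nth 0 Y j 0 k.
  apply: contrapT => h; apply: yij => k; apply/eqP/negP => /negP yk.
  by apply: h; exists k.
(* The rows differ in a coordinate, which is the value of the extension at an interior point; so the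
   solutions differ inside the prescribed range. *)
exists k.+1%:Z; split; last by rewrite !extE_in.
by have := ltn_ord k; lia.
Qed.
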